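(* Let $\mu$ be a probability measure on $X$, let $\alpha$ be a Young function satisfying the $\Delta_2$-condition, and let $p_\alpha=\sup_{x>0}\frac{x\alpha'_+(x)}{\alpha(x)}>1$. The following statements are equivalent: (1) there exists $C>0$ such that $\mu$ satisfies $\mathbf{T}_\alpha(C)$; (2) there exist $\lambda,A>0$ such that $\mu$ satisfies $(\tau)-\mathbf{LSI}_\alpha(\lambda,A)$. Moreover, the constants are related as follows. If $\mu$ satisfies $\mathbf{T}_\alpha(C)$, then $\mu$ satisfies $(\tau)-\mathbf{LSI}_\alpha(\lambda,A)$ for any $\lambda\in(0,1/C)$ with $A=\frac{1}{1-\lambda C}$. If $\mu$ satisfies $(\tau)-\mathbf{LSI}_\alpha(\lambda,A)$, then $\mu$ satisfies $\mathbf{T}_\alpha(C)$ with $$C=\frac1\lambda\,\kappa_{p_\alpha}\max(A;1)^{p_\alpha-1},\qquad \kappa_{p_\alpha}=\frac{p_\alpha^{p_\alpha(p_\alpha-1)}}{(p_\alpha-1)^{(p_\alpha-1)^2}}.$$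
   Context: Throughout, $(X,d)$ is a complete separable metric space whose closed balls are compact; measures are Borel. A Young function is an even convex function $\alpha:\mathbb{R}\to\mathbb{R}^+$ (finite valued), increasing on $\mathbb{R}^+$, with $\alpha(0)=0$ and $\alpha'(0)=0$. It satisfies the $\Delta_2$-condition if there is a constant $K>0$ with $\alpha(2x)\le K\alpha(x)$ for all $x\in\mathbb{R}$. $\alpha'_+$ denotes the right derivative. Optimal transport cost: $\mathcal{T}_\alpha(\nu,\mu)=\inf_\pi\iint\alpha(d(x,y))\,d\pi(x,y)$, the infimum being over all probability measures $\pi$ on $X\times X$ with marginals $\nu$ and $\mu$. Relative entropy: $H(\nu|\mu)=\int\log\frac{d\nu}{d\mu}\,d\nu$ if $\nu\ll\mu$, and $+\infty$ otherwise. $\mu$ satisfies $\mathbf{T}_\alpha(C)$ if $\mathcal{T}_\alpha(\nu,\mu)\le C\,H(\nu|\mu)$ for all probability measures $\nu$ on $X$. A function $f:X\to\mathbb{R}$ is locally Lipschitz if every $x\in X$ is the center of a ball $B$ with $\sup_{y,z\in B,\,y\ne z}\frac{|f(y)-f(z)|}{d(y,z)}<\infty$. For $g>0$, $\mathrm{Ent}_\mu(g)=\int g\log\frac{g}{\int g\,d\mu}\,d\mu$. For $\lambda,A>0$, $\mu$ satisfies $(\tau)-\mathbf{LSI}_\alpha(\lambda,A)$ if $\mathrm{Ent}_\mu(e^f)\le A\int(f-Q_\alpha^\lambda f)e^f\,d\mu$ for all bounded locally Lipschitz $f:X\to\mathbb{R}$, where $Q^\lambda_\alpha f(x)=\inf_{y\in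 X}\{f(y)+\lambda\alpha(d(x,y))\}$. *)

(* Defs.v *)
From HB Require Import structures.
From mathcomp Require Import all_boot all_order all_algebra.
From mathcomp Require Import all_classical all_reals all_analysis.

Set Implicit Arguments.
Unset Strict Implicit.
Unset Printing Implicit Defensive.

Import Order.TTheory GRing.Theory Num.Theory.
Import numFieldNormedType.Exports.

Local Open Scope classical_set_scope.
Local Open Scope ring_scope.

(* [Complete] carries a base point, so these spaces are nonempty. *)
#[short(type="completeMetricType")]
HB.structure Definition CompleteMetric (K : numDomainType) :=
  {M of Metric K M & Complete M}.

Definition separable (X : topologicalType) : Prop :=
  exists2 D : set X, countable D & dense D.

(* The library's [closed_ball] is the closure of the open ball, which can be
   smaller than the set used here. *)
Definition compact_closed_balls (R : realType) (X : metricType R) : Prop :=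
  forall (x : X) (r : R), compact [set y : X | mdist x y <= r].

Notation borel X := (g_sigma_algebraType (@open X)).

(* Monotonicity is not strict. Strictness on the half-line then follows from
   convexity and [delta2], unless alpha is zero everywhere; in that case
   [young_exponent] below is 0, as x / 0 = 0. *)
Definition young_function (R : realType) (alpha : R -> R) : Prop :=
  [/\ [/\ forall x, 0 <= alpha x,
          forall x, alpha (- x) = alpha x &
          convex_function [set: R^o] alpha],
      {in `[0, +oo[ &, {homo alpha : x y / x <= y}},
      alpha 0 = 0 &
      is_derive (0 : R) 1 alpha 0].

Definition delta2 (R : realType) (alpha : R -> R) : Prop :=
  exists2 K : R, 0 < K & forall x, alpha (2 * x) <= K * alpha x.

Definition right_derive (R : realType) (alpha : R -> R) (x : R) : R :=
  lim ((alpha (x + h) - alpha x) / h @[h --> 0^'+]).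

(* The real [sup] of an unbounded set is 0; for a Young function satisfying
   [delta2] with constant K this set is bounded by K - 1, since
   x * right_derive alpha x <= alpha (2 * x) - alpha x. *)
Definition young_exponent (R : realType) (alpha : R -> R) : R :=
  sup [set x * right_derive alpha x / alpha x | x in [set x : R | 0 < x]].

Definition kappa (R : realType) (p : R) : R :=
  p `^ (p * (p - 1)) / (p - 1) `^ ((p - 1) ^+ 2).

(* [Radon_Nikodym] may be nonpositive, where [lne] is -oo, only on a
   nu-null set. *)
Definition relative_entropy d (T : measurableType d) (R : realType)
    (nu mu : probability T R) : \bar R :=
  if `[< nu `<< mu >]
  then (\int[nu]_x lne (Radon_Nikodym (charge_of_finite_measure nu) mu x))%E
  else +oo%E.

(* The inner integral is real-valued: it is meaningful for integrable g. *)
Definition entropy d (T : measurableType d) (R : realType)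
    (mu : probability T R) (g : T -> R) : \bar R :=
  (\int[mu]_x (g x * ln (g x / (\int[mu]_y g y)%R))%:E)%E.

Section transport.
Context (R : realType) (X : completeMetricType R).
Implicit Types (alpha : R -> R) (mu nu : probability (borel X) R).

(* On a separable metric space the product sigma-algebra of [borel X * borel X]
   is the Borel sigma-algebra of the product. *)
Definition coupling nu mu (pi : probability (borel X * borel X)%type R) : Prop :=
  forall A : set (borel X), measurable A ->
    pushforward pi fst A = nu A /\ pushforward pi snd A = mu A.

Definition transport_cost alpha nu mu : \bar R :=
  ereal_inf [set (\int[pi]_z (alpha (mdist (z.1 : X) (z.2 : X)))%:E)%E
            | pi in coupling nu mu].

Definition transport_entropy alpha mu (C : R) : Prop :=
  forall nu : probability (borel X) R,
    (transport_cost alpha nu mu <= C%:E * relative_entropy nu mu)%E.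

Definition locally_lipschitz (f : X -> R) : Prop :=
  forall x : X, exists2 r : R, 0 < r &
    has_ubound [set `|f yz.1 - f yz.2| / mdist yz.1 yz.2
               | yz in [set yz : X * X |
                         [/\ ball x r yz.1, ball x r yz.2 & yz.2 <> yz.1]]].

(* Extended-valued, as the infimum may be -oo for unbounded f. *)
Definition inf_convolution alpha (lambda : R) (f : X -> R) (x : X) : \bar R :=
  ereal_inf (range (fun y : X => (f y + lambda * alpha (mdist x y))%:E)).

Definition tau_LSI alpha mu (lambda A : R) : Prop :=
  forall f : X -> R, bounded_fun f -> locally_lipschitz f ->
    (entropy mu (expR \o f) <=
     A%:E * \int[mu]_x (((f x)%:E - inf_convolution alpha lambda f x) *
                        (expR (f x))%:E))%E.

End transport.

(* Main.v *)
(** From transport to logarithmic Sobolev: test the transport inequality on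
    [d nu = e^f / Z d mu] and use [f x - f y <= (f - Q f) x + lambda alpha (d x y)]
    under a coupling, together with Jensen's inequality [E f <= ln Z].

    Conversely, let [p] be the exponent of [alpha], [q = p - 1], and let
    [G_t h x = sup_y (h y - t^(-q) alpha (d x y))].  Since
    [alpha (s x) <= s^p alpha x] for [s >= 1], convexity of [alpha] makes [G] a
    supersolution of a semigroup law: [Q^lambda (k G_t h) >= k G_(t - s) h] as
    soon as [k = lambda s^q].  As [G_t h] is convex in [t^(-q)], the drop
    [G_t h - G_(t - s) h] is controlled by any later increment
    [G_t' h - G_t h], so the logarithmic Sobolev inequality and Gibbs'
    variational principle show that the free energy [k^-1 ln E e^(k G_t h)] does
    not decrease along a schedule on which [k] decreases to [0] while [t]
    increases to [1].  Comparing the two ends gives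
    [ln E e^(k h) <= k E f] whenever [h x - f y <= alpha (d x y)].  By the
    Donsker-Varadhan inequality this bounds the dual Kantorovich problem by
    the entropy.  The absence of a duality gap is reduced to finite linear
    programming (Farkas' lemma): a coupling of the masses of the cells of a
    fine partition lifts to an exact coupling with a density with respect to
    the product measure, and the part far away is negligible because the
    exponential inequality forces [alpha (d x0 .)] to be integrable. *)

Require Import Defs.
From HB Require Import structures.
From mathcomp Require Import all_boot all_order all_algebra.
From mathcomp Require Import all_classical all_reals all_analysis.
From mathcomp Require Import measurable_realfun ring lra.

Set Implicit Arguments.
Unset Strict Implicit.
Unset Printing Implicit Defensive.

Import Order.TTheory GRing.Theory Num.Theory.
Import numFieldNormedType.Exports.

Local Open Scope classical_set_scope.
Local Open Scope ring_scope.

(** * Elementary inequalities *)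

Section real_inequalities.
Variable R : realType.
Implicit Types (u w x q B b : R).

(** Bernoulli's inequality, from concavity of [ln] between [u] and [1] with weights [x] and
    [1 - x]. *)
Lemma powR_le_tangent u x : 0 < u -> 0 <= x <= 1 ->
  u `^ x <= 1 + x * (u - 1).
Proof.
move=> u0 /andP[x0 x1].
have pos : 0 < 1 + x * (u - 1) by nra.
rewrite /powR gt_eqF// -[leRHS]lnK// ler_expR.
have x01 : (0 <= x <= 1) by rewrite x0 x1.
have := @concave_ln R (Itv01 x0 x1) u 1 u0 ltr01.
rewrite !convRE/= ln1 mulr0 addr0 mulr1 /unstable.onem => /le_trans; apply.
by rewrite (_ : x * u + (1 - x) = 1 + x * (u - 1))//; ring.
Qed.

(** The convex function [u ^ (- q)] lies above its tangent at [1]; the inverse has been cleared. *)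
Lemma powR_tangent u q : 0 < u -> 0 <= q -> u `^ q * (1 - q * (u - 1)) <= 1.
Proof.
move=> u0 q0.
have ue : 0 < u `^ q by exact: powR_gt0.
rewrite -ler_pdivlMl// mulr1 -powRN /powR gt_eqF//.
apply: le_trans (expR_ge1Dx _).
have : ln u <= u - 1.
  by have := @le_ln1Dx R (u - 1); rewrite subrKC; apply; rewrite ltrBDr addNr.
nra.
Qed.

(* The times [t = w / (1 + w)] and [t1 = b w / (1 + b w)] enter through
   [r = (1 - t) / (1 - t1)] and [r / b = t / t1]. *)
Lemma odds_step_ineq q w b B r : 0 < q -> 0 < w -> 1 < b -> 0 <= B ->
  B * b `^ (q + 1) <= 1 -> r = (b * w + 1) / (w + 1) ->
  (r `^ q - 1) * (B / w) <= 1 - (r / b) `^ q.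
Proof.
move=> q0 w0 b1 B0 Bb rE.
have b0 : 0 < b by lra.
have w10 : 0 < w + 1 by lra.
have r0 : 0 < r by rewrite rE divr_gt0//; nra.
set rq := r `^ q; have rq0 : 0 < rq by exact: powR_gt0.
have bq0 : 0 < b `^ q by exact: powR_gt0.
have r1 : r - 1 = w * (b - 1) / (w + 1) by rewrite rE; field; lra.
have s1 : r / b - 1 = - ((b - 1) / (b * (w + 1))) by rewrite rE; field; lra.
have h1 : rq - 1 <= rq * (q * (r - 1)).
  by have := powR_tangent r0 (ltW q0); rewrite -/rq; lra.
have h2 : (r / b) `^ q * (q * ((b - 1) / (b * (w + 1)))) <= 1 - (r / b) `^ q.
  have := powR_tangent (divr_gt0 r0 b0) (ltW q0); rewrite s1; lra.
apply: le_trans h2.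
have -> : (r / b) `^ q = rq / b `^ q.
  by rewrite powRM ?invr_ge0 ?ltW// -powR_inv1 ?ltW// -powRrM mulN1r powRN.
apply: (@le_trans _ _ ((rq * (q * (r - 1))) * (B / w))).
  by rewrite ler_wpM2r// divr_ge0// ltW.
(* After linearising, both sides share the factor [rq * q * (b - 1) / (w + 1)]; what is left is
   [B <= (b ^ q * b)^-1], the hypothesis on [B]. *)
rewrite r1.
have -> : rq * (q * (w * (b - 1) / (w + 1))) * (B / w) =
          rq * q * (b - 1) / (w + 1) * B by field; lra.
have -> : rq / b `^ q * (q * ((b - 1) / (b * (w + 1)))) =
          rq * q * (b - 1) / (w + 1) * (b `^ q * b)^-1.
  by field; rewrite !gt_eqF.
rewrite ler_wpM2l//.
  by rewrite !mulr_ge0// ?invr_ge0 ?subr_ge0 ltW.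
rewrite -[leRHS]mul1r ler_pdivlMr ?mulr_gt0//.
by move: Bb; rewrite powRD ?(gt_eqF b0) ?implybT// powRr1// ltW.
Qed.

(* Twice Bernoulli: [(1 - 1/p)^x <= 1 - x/p] and [M^x <= 1 + x (M - 1)]. *)
Lemma powRN_le_chord q x : 0 < q -> 0 <= x <= 1 ->
  (1 - x / (q + 1)) `^ (- q) <=
  1 + x * (((q + 1) / q) `^ q - 1).
Proof.
move=> q0 x01; have /andP[x0 x1] := x01.
set p := q + 1; have p0 : 0 < p by rewrite /p; lra.
have qp0 : 0 < q / p by rewrite divr_gt0.
have h1 : (q / p) `^ x <= 1 - x / p.
  apply: le_trans (powR_le_tangent qp0 x01) _.
  by rewrite le_eqVlt; apply/orP; left; apply/eqP; rewrite /p; field; rewrite gt_eqF.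
have M0 : 0 < (p / q) `^ q by rewrite powR_gt0// divr_gt0.
apply: le_trans (powR_le_tangent M0 x01).
have h0 : 0 < (q / p) `^ x by rewrite powR_gt0.
have -> : ((p / q) `^ q) `^ x = ((q / p) `^ (x * q))^-1.
  by rewrite -powRrM -[p / q]invf_div -(powR_inv1 (ltW qp0)) -powRrM mulN1r powRN (mulrC q x).
have xp0 : 0 < 1 - x / p by exact: lt_le_trans h1.
rewrite powRN lef_pV2 ?posrE ?powR_gt0//.
rewrite powRrM; apply: ge0_ler_powR => //; rewrite ?nnegrE ltW//.
Qed.

Lemma le_invr_expR x : 0 < 1 - x -> expR x <= (1 - x)^-1.
Proof.
move=> x1; rewrite -[leLHS]invrK -expRN lef_pV2 ?posrE ?expR_gt0//.
by have := expR_ge1Dx (- x).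
Qed.

Lemma le_invr_quad x : `|x| <= 2^-1 -> (1 - x)^-1 <= 1 + x + 2 * x ^+ 2.
Proof.
rewrite ler_norml => /andP[x1 x2]; have x12 : 0 < 1 - x by lra.
rewrite -[leLHS]mul1r ler_pdivrMr//.
have : 0 <= x ^+ 2 * (1 - 2 * x) by rewrite mulr_ge0 ?sqr_ge0//; lra.
nra.
Qed.

Lemma le_expR_quad x : `|x| <= 2^-1 -> expR x <= 1 + x + 2 * x ^+ 2.
Proof.
move=> x2; apply: le_trans (le_invr_quad x2); apply: le_invr_expR.
by move: x2; rewrite ler_norml => /andP[]; lra.
Qed.
Lemma powR_div x u q : 0 <= x -> 0 <= u -> (x / u) `^ q = x `^ q / u `^ q.
Proof.
by move=> x0 u0; rewrite powRM ?invr_ge0// -(powR_inv1 u0) -powRrM mulN1r powRN.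
Qed.

End real_inequalities.

(** * Young functions *)

Section young.
Context (R : realType) (alpha : R -> R).
Context (young_alpha : young_function alpha).

Lemma young_ge0 x : 0 <= alpha x.
Proof. by case: young_alpha => -[]. Qed.

Lemma young0 : alpha 0 = 0.
Proof. by case: young_alpha. Qed.

Lemma young_mono x y : 0 <= x -> x <= y -> alpha x <= alpha y.
Proof.
by case: young_alpha => _ h _ _ x0 xy; apply: h; rewrite // in_itv/= ?x0 ?(le_trans x0).
Qed.

Lemma young_convex (t x y : R) : 0 <= t <= 1 ->
  alpha (t * x + (1 - t) * y) <= t * alpha x + (1 - t) * alpha y.
Proof.
case: young_alpha => -[_ _ cvx] _ _ _ /andP[t0 t1].
have := cvx (Itv01 t0 t1) x y; rewrite !inE => /(_ Logic.I Logic.I).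
by rewrite !convRE.
Qed.

(** The three-slope inequality, multiplied out so that coinciding points are allowed. *)
Lemma young_slope x y z : x <= y -> y <= z ->
  (alpha y - alpha x) * (z - y) <= (alpha z - alpha y) * (y - x).
Proof.
move=> xy yz; have [zx|xz] := eqVneq z x.
  have -> : y = x by rewrite zx in yz; lra.
  by rewrite zx; lra.
have zx : 0 < z - x by rewrite subr_gt0 lt_neqAle eq_sym xz (le_trans xy).
have := @young_convex ((z - y) / (z - x)) x z.
have -> : (z - y) / (z - x) * x + (1 - (z - y) / (z - x)) * z = y.
  by field; rewrite gt_eqF.
have -> : 1 - (z - y) / (z - x) = (y - x) / (z - x) by field; rewrite gt_eqF.
have t01 : 0 <= (z - y) / (z - x) <= 1.
  apply/andP; split; first by rewrite divr_ge0 ?subr_ge0 ?(le_trans xy).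
  by rewrite ler_pdivrMr// mul1r; lra.
move=> /(_ t01).
rewrite -(ler_pM2r zx) mulrDl.
have -> : (z - y) / (z - x) * alpha x * (z - x) = (z - y) * alpha x.
  by field; rewrite gt_eqF.
have -> : (y - x) / (z - x) * alpha z * (z - x) = (y - x) * alpha z.
  by field; rewrite gt_eqF.
nra.
Qed.

(** The slope on [[x, y]] is at most that of the chord from [y] to [r + 1], whose length is at least
    [1]. *)
Lemma young_lipschitz r x y : 0 <= x -> x <= y -> y <= r ->
  alpha y - alpha x <= alpha (r + 1) * (y - x).
Proof.
move=> x0 xy yr; have yr1 : y <= r + 1 by lra.
have := young_slope xy yr1.
have := young_ge0 y; have := young_ge0 (r + 1).
have : alpha x <= alpha y by exact: young_mono.
have : 1 <= r + 1 - y by lra.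
nra.
Qed.

Lemma young_ge_linear x : 1 <= x -> x * alpha 1 <= alpha x.
Proof.
move=> x1; have x0 : 0 < x by lra.
have t01 : 0 <= x^-1 <= 1 by rewrite invr_ge0 (ltW x0) invf_le1.
have := @young_convex x^-1 x 0 t01.
rewrite mulVf ?gt_eqF// mulr0 addr0 young0 mulr0 addr0.
by rewrite ler_pdivlMl.
Qed.

Let slope (y h : R) := (alpha (y + h) - alpha y) / h.

Let slope_homo (y h k : R) : 0 < h -> h <= k -> slope y h <= slope y k.
Proof.
move=> h0 hk; have k0 : 0 < k by lra.
rewrite /slope ler_pdivrMr// mulrAC ler_pdivlMr//.
have yh : y <= y + h by lra.
have hk' : y + h <= y + k by lra.
have := young_slope yh hk'; nra.
Qed.

Let slope_ge (x y h : R) : x < y -> 0 < h -> (alpha y - alpha x) / (y - x) <= slope y h.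
Proof.
move=> xy h0; rewrite /slope ler_pdivrMr ?subr_gt0// mulrAC ler_pdivlMr//.
have := @young_slope x y (y + h); have -> : y + h - y = h by ring.
by apply; lra.
Qed.

Let slope_cvg y : cvg (slope y h @[h --> 0^'+]).
Proof.
apply: nondecreasing_at_right_is_cvgr.
  near=> b => h k; rewrite !in_itv/= => /andP[h0 _] _ hk.
  exact: slope_homo.
(* The chord from [y - 1] to [y] bounds all right difference quotients from below. *)
near=> b; exists ((alpha y - alpha (y - 1)) / (y - (y - 1))) => z [h /=].
rewrite in_itv/= => /andP[h0 _] <-; apply: slope_ge => //; lra.
Unshelve. all: by end_near. Qed.

Lemma right_derive_ge x y : x < y ->
  alpha y - alpha x <= (y - x) * right_derive alpha y.
Proof.
move=> xy; rewrite -ler_pdivrMl ?subr_gt0// mulrC.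
apply: limr_ge; first exact: slope_cvg.
near=> h; apply: slope_ge => //.
Unshelve. all: by end_near. Qed.

Lemma right_derive_le (y h : R) : 0 < h ->
  right_derive alpha y * h <= alpha (y + h) - alpha y.
Proof.
move=> h0; rewrite -ler_pdivlMr//; apply: limr_le; first exact: slope_cvg.
near=> k; apply: slope_homo => //.
near: k; exact: nbhs_right_le.
Unshelve. all: by end_near. Qed.

Context (delta2_alpha : delta2 alpha) (p_gt1 : 1 < young_exponent alpha).
Let p := young_exponent alpha.

(** A zero at some [x > 0] spreads to all [2 ^ n * x] by [delta2] and then to the half-line by
    monotonicity. All quotients in [young_exponent] would then be [0], against [1 < p]. *)
Lemma young_gt0 x : 0 < x -> 0 < alpha x.
Proof.
move=> x0; rewrite lt_neqAle young_ge0 andbT eq_sym; apply/negP => /eqP ax0.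
have [K K0 aK] := delta2_alpha.
have a2n n : alpha (2 ^+ n * x) = 0.
  elim: n => [|n ih]; first by rewrite mul1r.
  apply/eqP; rewrite eq_le young_ge0 andbT exprS -mulrA.
  by apply: le_trans (aK _) _; rewrite ih mulr0.
have a0 y : 0 < y -> alpha y = 0.
  move=> y0; apply/eqP; rewrite eq_le young_ge0 andbT.
  have [n yn] : exists n, y / x <= 2 ^+ n.
    exists (Num.truncn (y / x)).+1; apply: le_trans (ltW (truncnS_gt _)) _.
    by rewrite -natrX ler_nat ltnW// ltn_expl.
  rewrite -(a2n n) young_mono// ?(ltW y0)//.
  by rewrite -ler_pdivrMr.
move: p_gt1; rewrite /young_exponent.
rewrite (_ : [set _ | _ in _] = [set 0]); last first.
  apply/seteqP; split => [_ [z /= z0 <-]|_ ->] /=; first by rewrite a0// invr0 mulr0.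
  by exists 1 => //=; rewrite (a0 1)// invr0 mulr0.
by rewrite sup1 ltr10.
Qed.

(** The real [sup] is an upper bound only for bounded sets; [delta2] bounds the quotients by
    [K - 1]. *)
Lemma young_exponent_ge x : 0 < x -> x * right_derive alpha x <= p * alpha x.
Proof.
move=> x0; rewrite -ler_pdivrMr ?young_gt0//; apply: ub_le_sup; last by exists x.
have [K K0 aK] := delta2_alpha.
exists (K - 1) => _ [y /= y0 <-]; rewrite ler_pdivrMr ?young_gt0//.
have := right_derive_le y y0; have := aK y.
have -> : 2 * y = y + y by ring.
lra.
Qed.

(* One explicit Euler step for [x alpha' <= p alpha]. *)
Let young_scale_step x s : 0 < x -> 1 <= s ->
  alpha (s * x) * (1 - p * (1 - s^-1)) <= alpha x.
Proof.
move=> x0; rewrite le_eqVlt => /predU1P[<-|s1].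
  by rewrite mul1r invr1 subrr mulr0 subr0 mulr1.
have s0 : 0 < s by lra.
have xy : x < s * x by nra.
have sx0 : 0 < s * x by rewrite mulr_gt0.
have := right_derive_ge xy; have := young_exponent_ge sx0.
rewrite -(ler_pM2l (_ : 0 < 1 - s^-1)); last by rewrite subr_gt0 invf_lt1.
have -> : (1 - s^-1) * (s * x * right_derive alpha (s * x)) =
  (s * x - x) * right_derive alpha (s * x) by field; rewrite gt_eqF.
nra.
Qed.

(** Euler's method on a logarithmic scale. With [L = p ln s], the factor [s] is split into [N] equal
    factors [r]; each costs at most [(1 - v)^-1 <= expR (v + 2 v^2)] with [v = L / N]. Together they
    cost [expR (L + 2 L^2 / N)], and [N] tends to infinity. *)
Lemma young_scale x s : 0 <= x -> 1 <= s -> alpha (s * x) <= s `^ p * alpha x.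
Proof.
rewrite le_eqVlt => /predU1P[<- _|x0 s1].
  by rewrite mulr0 young0 mulr0.
have s0 : 0 < s by lra.
pose L := p * ln s.
have p0 : 0 < p by exact: lt_trans p_gt1.
have L0 : 0 <= L by rewrite mulr_ge0 ?ln_ge0// ltW.
have spE : s `^ p = expR L by rewrite /powR gt_eqF.
have main n : 2 * L <= n.+1%:R -> alpha (s * x) <= expR (L + 2 * L ^+ 2 / n.+1%:R) * alpha x.
  move=> nL; set N : R := n.+1%:R; have N0 : 0 < N by rewrite /N ltr0n.
  pose v := L / N; pose r := expR (ln s / N).
  have r1 : 1 <= r by rewrite /r -expR0 ler_expR divr_ge0 ?ln_ge0// ltW.
  have v2 : `|v| <= 2^-1.
    by rewrite ger0_norm ?divr_ge0 ?(ltW N0)// /v ler_pdivrMr//; move: nL; rewrite -/N; lra.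
  have v0 : 0 <= v by rewrite divr_ge0// ltW.
  have v1 : 0 < 1 - v by move: v2; rewrite ger0_norm//; lra.
  have rv : 1 - v <= 1 - p * (1 - r^-1).
    rewrite /r -expRN lerD2l lerN2 /v /L -mulrA ler_wpM2l ?(ltW p0)//.
    rewrite lerBlDr -lerBlDl; exact: expR_ge1Dx.
  have stp y : 0 < y -> alpha (r * y) <= expR (v + 2 * v ^+ 2) * alpha y.
    move=> y0; apply: (@le_trans _ _ ((1 - v)^-1 * alpha y)); last first.
      rewrite ler_wpM2r ?young_ge0//; apply: le_trans (le_invr_quad v2) _.
      by apply: le_trans (expR_ge1Dx _); rewrite addrA.
    rewrite ler_pdivlMl// mulrC; apply: le_trans (young_scale_step y0 r1).
    by rewrite ler_wpM2l// young_ge0.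
  have iter k : alpha (r ^+ k * x) <= expR (v + 2 * v ^+ 2) ^+ k * alpha x.
    elim: k => [|k ih]; first by rewrite !expr0 !mul1r.
    have rk : 0 < r ^+ k * x by rewrite mulr_gt0// exprn_gt0// expR_gt0.
    rewrite (exprS r) (exprS (expR _)) -!mulrA; apply: le_trans (stp _ rk) _.
    by apply: ler_wpM2l => //; exact: expR_ge0.
  have := iter n.+1; rewrite -!expRM_natl -/N.
  have -> : N * (ln s / N) = ln s by field; rewrite gt_eqF.
  rewrite lnK//.
  by have -> : N * (v + 2 * v ^+ 2) = L + 2 * L ^+ 2 / N by rewrite /v; field; rewrite gt_eqF.
have ax := young_gt0 x0.
rewrite spE -ler_pdivrMr// -[leRHS]lnK ?posrE ?expR_gt0//.
have asx : 0 < alpha (s * x) / alpha x by rewrite divr_gt0// young_gt0// mulr_gt0.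
rewrite -[leLHS]lnK// ler_expR expRK.
apply/ler_addgt0Pr => e e0.
pose n := Num.truncn (Num.max (2 * L) (2 * L ^+ 2 / e)).
have := truncnS_gt (Num.max (2 * L) (2 * L ^+ 2 / e)).
rewrite gt_max -/n => /andP[n1 n2].
have := main n (ltW n1); rewrite -ler_pdivrMr// -[leLHS]lnK// ler_expR => /le_trans; apply.
by rewrite lerD2l ler_pdivrMr ?ltr0n// (mulrC e) -ler_pdivrMr// ltW.
Qed.

(** Write [u + v] as the convex combination of [u / (1 - a)] and [v / a], then take the dilations
    out with [young_scale]. *)
Lemma young_add_weighted a u v : 0 < a < 1 -> 0 <= u -> 0 <= v ->
  alpha (u + v) <= (1 - a) `^ (1 - p) * alpha u + a `^ (1 - p) * alpha v.
Proof.
move=> /andP[a0 a1] u0 v0; have b0 : 0 < 1 - a by lra.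
have sc c w : 0 < c -> c <= 1 -> 0 <= w -> c * alpha (c^-1 * w) <= c `^ (1 - p) * alpha w.
  move=> c0 c1 w0; have c1' : 1 <= c^-1 by rewrite invf_ge1.
  have -> : c `^ (1 - p) = c * c `^ (- p).
    by rewrite powRD ?powRr1 ?ltW// (gt_eqF c0) implybT.
  rewrite -mulrA ler_wpM2l ?(ltW c0)//.
  apply: le_trans (young_scale w0 c1') _.
  by rewrite -(powR_inv1 (ltW c0)) -powRrM mulN1r.
have := @young_convex (1 - a) ((1 - a)^-1 * u) (a^-1 * v).
have -> : (1 - a) * ((1 - a)^-1 * u) + (1 - (1 - a)) * (a^-1 * v) = u + v.
  by field; rewrite !gt_eqF.
have -> : 1 - (1 - a) = a by ring.
have a01 : 0 <= 1 - a <= 1 by lra.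
move=> /(_ a01) /le_trans; apply; apply: lerD; apply: sc => //; lra.
Qed.

Lemma young_double : exists2 K, 0 < K &
  forall u v, 0 <= u -> 0 <= v -> alpha (u + v) <= K * alpha (Num.max u v).
Proof.
have [K K0 aK] := delta2_alpha; exists K => // u v u0 v0.
apply: le_trans (aK _); apply: young_mono; first exact: addr_ge0.
have -> : 2 * Num.max u v = Num.max u v + Num.max u v by ring.
by apply: lerD; rewrite le_max lexx ?orbT.
Qed.

End young.

(** * Finite linear programming *)

Section farkas.
Context (R : realFieldType) (V : lmodType R) (I : eqType).

Let lin (f : V -> R) := forall k x y, f (k *: x + y) = k * f x + f y.

(* Bartl's induction on the number of functionals: if the first ones do not
   suffice, a violating [x] lets one project along [x] onto the kernel of the
   last functional. *)
Lemma farkas (s : seq I) (a : I -> V -> R) (b : V -> R) :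
  uniq s -> (forall i, lin (a i)) -> lin b ->
  (forall x, (forall i, i \in s -> a i x <= 0) -> b x <= 0) ->
  exists2 l : I -> R, forall i, 0 <= l i &
    forall x, b x = \sum_(i <- s) l i * a i x.
Proof.
have lin0 f : lin f -> f 0 = 0.
  by move=> /(_ 1 0 0); rewrite scaler0 addr0 mul1r => /eqP; rewrite addrC -subr_eq subrr => /eqP.
have linZ f k x : lin f -> f (k *: x) = k * f x.
  by move=> lf; have := lf k x 0; rewrite addr0 lin0// addr0.
elim: s a b => [|i s ih] a b /=.
  move=> _ _ lb bn; exists (fun=> 0) => // x; rewrite big_nil.
  have bN y : b y <= 0 by apply: bn => i; rewrite in_nil.
  apply/eqP; rewrite eq_le bN/=.
  by have := bN (- x); rewrite -scaleN1r linZ// mulN1r oppr_le0.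
move=> /andP[si us] la lb H.
have [Hs|] := pselect (forall x, (forall j, j \in s -> a j x <= 0) -> b x <= 0).
  have [l l0 bE] := ih a b us la lb Hs.
  exists (fun j => if j == i then 0 else l j) => [j|x]; first by case: ifP.
  rewrite big_cons eqxx mul0r add0r bE; apply: eq_big_seq => j js.
  by case: eqP js => // ->; rewrite (negbTE si).
move=> /existsNP[x0 /not_implyP[ax0 /negP]]; rewrite -ltNge => bx0.
have aix0 : 0 < a i x0.
  rewrite ltNge; apply/negP => aix0.
  have := H x0; rewrite leNgt bx0 => /(_ _)/negP; apply => // j.
  by rewrite inE => /predU1P[->//|]; exact: ax0.
pose x := (a i x0)^-1 *: x0.
have aix : a i x = 1 by rewrite linZ// mulVf// gt_eqF.
have bx : 0 < b x by rewrite linZ// mulr_gt0// invr_gt0.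
have ax j : j \in s -> a j x <= 0.
  by move=> js; rewrite linZ// pmulr_rle0 ?invr_gt0// ax0.
pose a' j y := a j y - a j x * a i y.
pose b' y := b y - b x * a i y.
have la' j : lin (a' j) by move=> k y z; rewrite /a' !la; ring.
have lb' : lin b' by move=> k y z; rewrite /b' lb la; ring.
have [|l l0 b'E] := ih a' b' us la' lb'.
  move=> y a'y; have := H (- a i y *: x + y).
  rewrite lb (_ : _ * _ + _ = b' y); last by rewrite /b'; ring.
  apply => j; rewrite inE la => /predU1P[->|js]; first by rewrite aix mulr1 addNr.
  by rewrite (_ : _ * _ + _ = a' j y) ?a'y// /a'; ring.
(* The weight of [a i] is forced by evaluating the identity at [x], where [a i x = 1]; it is
   nonnegative because [a j x <= 0 < b x]. *)
pose c := b x - \sum_(j <- s) l j * a j x.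
have c0 : 0 <= c.
  rewrite subr_ge0; apply: le_trans (ltW bx); rewrite big_seq; apply: sumr_le0 => j js.
  by rewrite mulr_ge0_le0// ax.
exists (fun j => if j == i then c else l j) => [j|y]; first by case: ifP.
rewrite big_cons eqxx.
rewrite (@eq_big_seq _ _ _ _ _ _ (fun j => l j * a' j y + l j * a j x * a i y)); last first.
  move=> j js; case: eqP js => [->|_ _]; first by rewrite (negbTE si).
  by rewrite /a'; ring.
rewrite big_split/= -b'E -mulr_suml /b' /c; ring.
Qed.

End farkas.

Section finite_kantorovich.
Context (R : realFieldType) (I : finType).
Context (a b : I -> R) (c : I -> I -> R) (D : R).

(** Farkas' lemma on triples [(g, f, t)], with the dual problem made homogeneous:
    [g i - f j <= c i j * t] and [0 <= t] imply that [obj] is at most [0]. The multipliers of the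
    constraints indexed by pairs form the coupling. *)
Lemma finite_kantorovich :
  (forall i, 0 <= a i) -> (forall i, 0 <= b i) ->
  \sum_i a i = 1 -> \sum_i b i = 1 ->
  (forall g f : I -> R, (forall i j, g i - f j <= c i j) ->
    \sum_i a i * g i - \sum_j b j * f j <= D) ->
  exists pi : I -> I -> R,
    [/\ forall i j, 0 <= pi i j, forall i, \sum_j pi i j = a i,
        forall j, \sum_i pi i j = b j &
        \sum_i \sum_j pi i j * c i j <= D].
Proof.
move=> a0 b0 a1 b1 H.
pose V : lmodType R := ({ffun I -> R^o} * {ffun I -> R^o} * R^o)%type.
pose con (k : option (I * I)) (x : V) : R :=
  if k is Some ij then x.1.1 ij.1 - x.1.2 ij.2 - c ij.1 ij.2 * x.2 else - x.2.
pose obj (x : V) : R :=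
  \sum_i a i * x.1.1 i - \sum_j b j * x.1.2 j - D * x.2.
have lcon k r x y : con k (r *: x + y) = r * con k x + con k y.
  case: k => [ij|] /=; last by rewrite /GRing.scale/=; ring.
  by rewrite !ffunE /GRing.scale/=; ring.
have lobj r x y : obj (r *: x + y) = r * obj x + obj y.
  rewrite /obj (eq_bigr (fun i => r * (a i * x.1.1 i) + a i * y.1.1 i)); last first.
    by move=> i _ /=; rewrite !ffunE /GRing.scale/=; ring.
  rewrite [X in _ - X - _](eq_bigr (fun j => r * (b j * x.1.2 j) + b j * y.1.2 j)); last first.
    by move=> j _ /=; rewrite !ffunE /GRing.scale/=; ring.
  by rewrite !big_split/= -!mulr_sumr /GRing.scale/=; ring.
have [|l l0 objE] := @farkas R V _ (enum {: option (I * I)}) con obj (enum_uniq _) lcon lobj.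
  move=> x xcon; have xc k : con k x <= 0 by apply: xcon; rewrite mem_enum.
  have t0 : 0 <= x.2 by have := xc None; rewrite /= oppr_le0.
  have xij i j : x.1.1 i - x.1.2 j <= c i j * x.2.
    by have := xc (Some (i, j)); rewrite /= subr_le0.
  rewrite /obj; move: t0; rewrite le_eqVlt => /predU1P[t0|t0].
    (* At [t = 0] the constraints say [g i <= f j] for all pairs; average them with weights
       [a i * b j]. For [t > 0] below, divide by [t]. *)
    rewrite -t0 mulr0 subr0 subr_le0.
    rewrite -[leLHS]mulr1 -[leRHS]mulr1 -{1}b1 -{1}a1 !big_distrlr/= exchange_big/=.
    apply: ler_sum => j _; apply: ler_sum => i _.
    have -> : a i * x.1.1 i * b j = a i * b j * x.1.1 i by ring.
    have -> : b j * x.1.2 j * a i = a i * b j * x.1.2 j by ring.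
    rewrite ler_wpM2l ?mulr_ge0//.
    by have := xij i j; rewrite -t0 mulr0 subr_le0.
  have := H (fun i => x.2^-1 * x.1.1 i) (fun j => x.2^-1 * x.1.2 j).
  move=> /(_ _) Hx; rewrite subr_le0 -ler_pdivrMr// mulrC mulrBr !mulr_sumr.
  rewrite (eq_bigr (fun i => a i * (x.2^-1 * x.1.1 i))); last by move=> i _; ring.
  rewrite [X in _ - X](eq_bigr (fun i => b i * (x.2^-1 * x.1.2 i))); last by move=> i _; ring.
  by apply: Hx => i j; rewrite -mulrBr ler_pdivrMl// mulrC.
have objS x : obj x = \sum_i \sum_j l (Some (i, j)) * con (Some (i, j)) x + l None * con None x.
  rewrite objE big_enum/= (bigD1 None)//= addrC; congr (_ + _).
  rewrite pair_big/= (reindex_omap Some id)/=; last by case.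
  by apply: eq_big => [[i j]|[i j] _]//=; rewrite eqxx.
pose pi i j := l (Some (i, j)).
have delta (F : I -> R) i : \sum_k F k * (k == i)%:R = F i.
  by rewrite (bigD1 i)//= eqxx mulr1 big1 ?addr0// => k /negbTE ->; rewrite mulr0.
(* Evaluating the multiplier identity at coordinate vectors gives the two marginals; at [(0, 0, 1)]
   it gives the cost as [D] minus the nonnegative multiplier [l None]. *)
exists pi; split=> [i j|i|j|]; first exact: l0.
- have := objS ([ffun k => (k == i)%:R], 0, 0); rewrite /obj /con/= !(mulr0, oppr0, addr0, subr0).
  rewrite [X in _ - X]big1 ?subr0; last by move=> j _; rewrite ffunE mulr0.
  rewrite (eq_bigr (fun k => a k * (k == i)%:R)); last by move=> k _; rewrite ffunE.
  rewrite delta => ->; rewrite [RHS](eq_bigr (fun k => (\sum_j pi k j) * (k == i)%:R)); last first.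
    by move=> k _; rewrite mulr_suml; apply: eq_bigr => j _; rewrite !ffunE /pi; ring.
  by rewrite delta.
- have := objS (0, [ffun k => (k == j)%:R], 0); rewrite /obj /con/= !(mulr0, oppr0, addr0, subr0).
  rewrite [X in X - _]big1 ?sub0r; last by move=> i _; rewrite ffunE mulr0.
  rewrite (eq_bigr (fun k => b k * (k == j)%:R)); last by move=> k _; rewrite ffunE.
  rewrite delta exchange_big/= => /eqP; rewrite eqr_oppLR => /eqP ->.
  rewrite -sumrN [RHS](eq_bigr (fun k => (\sum_i pi i k) * (k == j)%:R)).
    by rewrite delta.
  move=> k _; rewrite mulr_suml -sumrN; apply: eq_bigr => i _; rewrite !ffunE /pi; ring.
- have SE : \sum_i \sum_j l (Some (i, j)) * con (Some (i, j)) (0, 0, 1) =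
      - \sum_i \sum_j pi i j * c i j.
    rewrite -sumrN; apply: eq_bigr => i _; rewrite -sumrN; apply: eq_bigr => j _.
    by rewrite /con/= !ffunE /pi; ring.
  have := objS (0, 0, 1); rewrite SE /obj /con/=.
  rewrite [X in X - _ - _]big1; last by move=> i _; rewrite ffunE mulr0.
  rewrite [X in _ - X - _]big1; last by move=> i _; rewrite ffunE mulr0.
  by have := l0 None; lra.
Qed.

End finite_kantorovich.

(** * Borel measurability on a metric space *)

Lemma countable_bigcup_measurable d (T : measurableType d) (U : Type)
    (D : set U) (F : U -> set T) : countable D ->
  (forall u, D u -> measurable (F u)) -> measurable (\bigcup_(u in D) F u).
Proof.
move=> /countable_injP[f finj] mF.
have -> : \bigcup_(u in D) F u = \bigcup_n \bigcup_(u in D `&` f @^-1` [set n]) F u.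
  apply/seteqP; split => [x [u Du Fx]|x [n _ [u [Du _] Fx]]]; last by exists u.
  by exists (f u) => //; exists u.
apply: bigcupT_measurable => n.
have [[u Du un]|nD] := pselect (exists2 u, D u & f u = n).
  rewrite (_ : D `&` _ = [set u]) ; first by rewrite bigcup_set1; exact: mF.
  apply/seteqP; split => [v [Dv vn]|_ ->]; last by split.
  by apply: finj; rewrite ?inE//; exact: etrans vn (esym un).
rewrite (_ : D `&` _ = set0); first by rewrite bigcup_set0; exact: measurable0.
by apply/seteqP; split => // v [Dv vn]; apply: nD; exists v.
Qed.

Section borel.
Context (R : realType) (X : completeMetricType R).

Lemma open_mdistP (A : set X) :
  (forall x, A x -> exists2 e : R, 0 < e & forall y, mdist x y < e -> A y) ->
  open A.
Proof.
move=> H; rewrite openE => x /H[e e0 xe]; apply/nbhs_ballP; exists e => //= y.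
by rewrite ballEmdist => /xe.
Qed.

Lemma open_mball (x : X) (e : R) : open (ball x e).
Proof.
rewrite ballEmdist; apply: open_mdistP => y /= xy.
exists (e - mdist x y); first by rewrite subr_gt0.
by move=> z yz; apply: le_lt_trans (metric_triangle x y z) _; lra.
Qed.

Lemma measurable_open (A : set X) : open A -> measurable (A : set (borel X)).
Proof. exact: sub_sigma_algebra. Qed.

Lemma lsc_measurable (f : X -> R) :
  (forall x a, a < f x -> exists2 e : R, 0 < e & forall y, mdist x y < e -> a < f y) ->
  measurable_fun setT (f : borel X -> R).
Proof.
move=> H mT; apply: (measurability _ (RGenOInfty.measurableE R)) => //.
move=> _ [_ [a ->] <-]; rewrite setTI; apply: measurable_open.
apply: open_mdistP => x /=; rewrite in_itv/= andbT => /H[e e0 he].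
by exists e => // y /he; rewrite in_itv/= andbT.
Qed.

Lemma usc_measurable (f : X -> R) :
  (forall x a, f x < a -> exists2 e : R, 0 < e & forall y, mdist x y < e -> f y < a) ->
  measurable_fun setT (f : borel X -> R).
Proof.
move=> H; have -> : f = (fun x => - (- f x)) by apply/funext => x; rewrite opprK.
apply: measurable_funN; apply: (@lsc_measurable (fun x => - f x)) => x a.
by rewrite ltrNr => /H[e e0 he]; exists e => // y /he; rewrite ltrNr.
Qed.

Lemma measurable_mdist (x : X) : measurable_fun setT (mdist x : borel X -> R).
Proof.
apply: usc_measurable => y a ya; exists (a - mdist x y); first by rewrite subr_gt0.
by move=> z yz; apply: le_lt_trans (metric_triangle x y z) _; lra.
Qed.

Lemma locally_lipschitz_measurable (f : X -> R) : locally_lipschitz f ->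
  measurable_fun setT (f : borel X -> R).
Proof.
move=> lf; apply: lsc_measurable => x a ax.
have [r r0 [L hL]] := lf x.
(* Within this distance the Lipschitz bound keeps the decrease below [f x - a]; the summand [1]
   keeps the denominator positive. *)
pose e := Num.min r ((f x - a) / (`|L| + 1)).
have L1 : 0 < `|L| + 1 by rewrite ltr_pwDr.
exists e; first by rewrite lt_min r0 divr_gt0// subr_gt0.
move=> y xy; have [->//|/eqP yx] := eqVneq y x.
have d0 : 0 < mdist x y by rewrite mdist_gt0; apply/eqP => /esym.
have := hL (`|f x - f y| / mdist x y) _; move=> /(_ _)h.
have : `|f x - f y| / mdist x y <= L.
  apply: h; exists (x, y) => //=; split => //; rewrite ballEmdist/= ?mdistxx//.
  by apply: lt_le_trans xy _; rewrite ge_min lexx.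
rewrite ler_pdivrMr// => fxy.
have : mdist x y * (`|L| + 1) < f x - a.
  by rewrite -ltr_pdivlMr//; apply: lt_le_trans xy _; rewrite ge_min lexx orbT.
have := ler_norm (f x - f y); have := ler_norm L.
nra.
Qed.

(** The distance of two points is below [a] exactly when some [u] of the countable dense set has
    distances to them summing to less than [a]. Each such condition is measurable for the product
    sigma-algebra. *)
Lemma measurable_mdist2 : separable X ->
  measurable_fun setT (fun z : borel X * borel X => mdist (z.1 : X) (z.2 : X)).
Proof.
move=> [D cD dD] mT; apply: (measurability _ (RGenInftyO.measurableE R)) => //.
move=> _ [_ [a ->] <-]; rewrite setTI.
pose F u := [set z : borel X * borel X | mdist u (z.1 : X) + mdist u (z.2 : X) < a].
have -> : (fun z : borel X * borel X => mdist (z.1 : X) (z.2 : X)) @^-1` `]-oo, a[%classic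
    = \bigcup_(u in D) F u.
  apply/seteqP; split => z /=; rewrite in_itv/=; last first.
    move=> [u Du]; rewrite /F/=; apply: le_lt_trans.
    by rewrite (metric_sym u); exact: metric_triangle.
  move=> za; pose e := (a - mdist (z.1 : X) (z.2 : X)) / 2.
  have e0 : 0 < e by rewrite divr_gt0// subr_gt0.
  have [u [zu Du]] := dD (ball (z.1 : X) e) (ex_intro _ (z.1 : X) (ballxx (z.1 : X) e0)) (open_mball (z.1 : X) e).
  exists u => //; rewrite /F/=.
  have {}zu : mdist u (z.1 : X) < e by move: zu; rewrite ballEmdist metric_sym.
  have := metric_triangle u (z.1 : X) (z.2 : X) => h.
  by move: zu h; rewrite /e; lra.
apply: countable_bigcup_measurable => // u _.
have mf : measurable_fun setT
    (fun z : borel X * borel X => mdist u (z.1 : X) + mdist u (z.2 : X)).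
  apply: measurable_funD.
    exact: (measurableT_comp (measurable_mdist u) measurable_fst).
  exact: (measurableT_comp (measurable_mdist u) measurable_snd).
have := mf measurableT _ (measurable_itv `]-oo, a[); rewrite setTI; congr measurable.
Qed.

End borel.

(** * Bounded measurable functions and free energy *)

Section bounded_measurable.
Context d (T : measurableType d) (R : realType).
Implicit Types (P : probability T R) (f g : T -> R).

(** Under a probability these functions are integrable, and they are stable under sums, products and
    [expR], so real-valued integrals can be manipulated freely. *)
Definition bounded_measurable f :=
  measurable_fun setT f /\ exists M : R, forall x, `|f x| <= M.

Lemma bounded_measurable_cst (c : R) : bounded_measurable (fun=> c).
Proof. by split; [exact: measurable_cst | exists `|c|]. Qed.

Lemma bounded_measurableD f g : bounded_measurable f -> bounded_measurable g ->
  bounded_measurable (fun x => f x + g x).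
Proof.
move=> [mf [M fM]] [mg [N gN]]; split; first exact: measurable_funD.
by exists (M + N) => x; apply: le_trans (ler_normD _ _) _; exact: lerD.
Qed.

Lemma bounded_measurableM f g : bounded_measurable f -> bounded_measurable g ->
  bounded_measurable (fun x => f x * g x).
Proof.
move=> [mf [M fM]] [mg [N gN]]; split; first exact: measurable_funM.
by exists (M * N) => x; rewrite normrM ler_pM.
Qed.

Lemma bounded_measurableZ (c : R) f : bounded_measurable f ->
  bounded_measurable (fun x => c * f x).
Proof. exact/bounded_measurableM/bounded_measurable_cst. Qed.

Lemma bounded_measurableB f g : bounded_measurable f -> bounded_measurable g ->
  bounded_measurable (fun x => f x - g x).
Proof.
move=> bf bg; apply: bounded_measurableD => //.
by under eq_fun do rewrite -mulN1r; exact: bounded_measurableZ.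
Qed.

Lemma bounded_measurable_expR f : bounded_measurable f ->
  bounded_measurable (fun x => expR (f x)).
Proof.
move=> [mf [M fM]]; split; first exact: measurableT_comp.
exists (expR M) => x; rewrite gtr0_norm ?expR_gt0// ler_expR.
exact: le_trans (ler_norm _) (fM x).
Qed.

Lemma bounded_measurable_integrable P f : bounded_measurable f ->
  P.-integrable setT (EFin \o f).
Proof.
move=> [mf [M fM]]; apply: measurable_bounded_integrable => //.
  by apply: le_lt_trans (probability_le1 P measurableT) _; exact: ltry.
exists M; split; first exact: num_real.
by move=> N MN x _ /=; apply: le_trans (fM x) (ltW MN).
Qed.

End bounded_measurable.

Ltac bmeas := repeat first
  [ assumption | exact: bounded_measurable_cst | apply: bounded_measurable_expR
  | apply: bounded_measurableB | apply: bounded_measurableD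
  | apply: bounded_measurableM | apply: bounded_measurable_integrable ].

Section expectation.
Context d (T : measurableType d) (R : realType) (P : probability T R).
Implicit Types (f g : T -> R).
Local Notation E f := (Rintegral P setT f).

Lemma expectD f g : bounded_measurable f -> bounded_measurable g ->
  E (fun x => f x + g x) = E f + E g.
Proof. by move=> bf bg; rewrite RintegralD//; bmeas. Qed.

Lemma expectB f g : bounded_measurable f -> bounded_measurable g ->
  E (fun x => f x - g x) = E f - E g.
Proof. by move=> bf bg; rewrite RintegralB//; bmeas. Qed.

Lemma expectZ c f : bounded_measurable f -> E (fun x => c * f x) = c * E f.
Proof. by move=> bf; rewrite RintegralZl//; bmeas. Qed.

Lemma expect_cst c : E (fun=> c) = c.
Proof.
have PT : (P : {measure set T -> \bar R}) setT = 1%E := probability_setT P.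
by rewrite Rintegral_cst// PT mulr1.
Qed.

Lemma expect_le f g : bounded_measurable f -> bounded_measurable g ->
  (forall x, f x <= g x) -> E f <= E g.
Proof. by move=> bf bg fg; apply: le_Rintegral; bmeas. Qed.

Lemma expect_ge0 f : (forall x, 0 <= f x) -> 0 <= E f.
Proof. by move=> f0; apply: Rintegral_ge0. Qed.

Lemma expect_EFin f : bounded_measurable f ->
  (\int[P]_x (f x)%:E)%E = (E f)%:E.
Proof.
move=> bf; rewrite /Rintegral fineK//; apply: integrable_fin_num => //.
exact: bounded_measurable_integrable.
Qed.

Lemma expect_expR_gt0 f : bounded_measurable f -> 0 < E (fun x => expR (f x)).
Proof.
move=> bf; have [_ [M fM]] := bf.
apply: (@lt_le_trans _ _ (expR (- M))); first exact: expR_gt0.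
rewrite -[leLHS]expect_cst; apply: expect_le; bmeas.
by move=> x; rewrite ler_expR; have := fM x; rewrite ler_norml => /andP[].
Qed.

(* Jensen's inequality for the probability with density [expR f / Z]. *)
Lemma gibbs_variational f g Z : bounded_measurable f -> bounded_measurable g ->
  Z = E (fun x => expR (f x)) ->
  ln Z + E (fun x => (g x - f x) * expR (f x)) / Z <= ln (E (fun x => expR (g x))).
Proof.
move=> bf bg ZE; have Z0 : 0 < Z by rewrite ZE; exact: expect_expR_gt0.
set c := _ / Z.
rewrite -ler_expR [leRHS]lnK ?posrE; last exact: expect_expR_gt0.
rewrite expRD lnK ?posrE//.
have bgf : bounded_measurable (fun x => (g x - f x) * expR (f x)).
  by bmeas.
(* [c] is the mean of [g - f] under the density [expR f / Z]; the tangent of the exponential at [c]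
   therefore integrates exactly to [Z * expR c]. *)
have -> : Z * expR c = E (fun x => expR c * ((g x - f x) * expR (f x) + (1 - c) * expR (f x))).
  rewrite expectZ; last by bmeas.
  rewrite expectD//; last by bmeas.
  rewrite expectZ; last by bmeas.
  by rewrite -ZE /c; field; rewrite gt_eqF.
apply: expect_le; bmeas.
move=> x; rewrite (_ : expR (g x) = expR c * (expR (g x - f x - c) * expR (f x))); last first.
  by rewrite -!expRD; congr expR; ring.
rewrite ler_wpM2l ?expR_ge0// -mulrDl ler_wpM2r ?expR_ge0//.
by have := expR_ge1Dx (g x - f x - c); lra.
Qed.

Definition rentropy f :=
  E (fun x => f x * expR (f x)) -
  E (fun x => expR (f x)) * ln (E (fun x => expR (f x))).

Lemma entropy_expR f : bounded_measurable f ->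
  entropy P (expR \o f) = (rentropy f)%:E.
Proof.
move=> bf; rewrite /entropy /rentropy/=.
set Z := E _; have Z0 : 0 < Z by exact: expect_expR_gt0.
have bh : bounded_measurable (fun x => f x * expR (f x) - ln Z * expR (f x)).
  by bmeas.
rewrite (eq_integral (fun x => (f x * expR (f x) - ln Z * expR (f x))%:E)); last first.
  move=> x _; congr EFin; rewrite ln_div ?posrE ?expR_gt0// expRK; ring.
rewrite expect_EFin// expectB; bmeas.
by rewrite expectZ; bmeas; rewrite -/Z mulrC.
Qed.

Lemma rentropy_ge_jensen f : bounded_measurable f ->
  ln (E (fun x => expR (f x))) >= E f.
Proof.
move=> bf; have := @gibbs_variational (fun=> 0) f _ (bounded_measurable_cst _ 0) bf erefl.
rewrite expR0 expect_cst ln1 add0r divr1.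
by under eq_Rintegral do rewrite subr0 mulr1.
Qed.

(** Gibbs' principle at [k1], tested with the density proportional to [expR (k g)], yields a gain
    [k1 I] from the increment [g1 - g] and a loss from lowering [k] to [k1]. The entropy bound
    limits the net loss to [(k - k1) c I], which is at most [k k1 I]. *)
Lemma free_energy_step k k1 c g g1 :
  bounded_measurable g -> bounded_measurable g1 -> (forall x, g x <= g1 x) ->
  0 < k1 -> k1 <= k ->
  rentropy (fun x => k * g x) <= c * E (fun x => (g1 x - g x) * expR (k * g x)) ->
  (k / k1 - 1) * c <= k ->
  k^-1 * ln (E (fun x => expR (k * g x))) <= k1^-1 * ln (E (fun x => expR (k1 * g1 x))).
Proof.
move=> bg bg1 gg1 k10 k1k ent ck; have k0 : 0 < k by exact: lt_le_trans k1k.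
have bkg : bounded_measurable (fun x => k * g x) by bmeas.
have bk1g : bounded_measurable (fun x => k1 * g1 x) by bmeas.
have := gibbs_variational bkg bk1g erefl.
set Z := E (fun x => expR (k * g x)).
have Z0 : 0 < Z by exact: expect_expR_gt0.
set W := ln (E _).
move: ent; rewrite /rentropy -/Z.
set I := E (fun x => (g1 x - g x) * expR (k * g x)).
have be : bounded_measurable (fun x => expR (k * g x)) by bmeas.
have bge : bounded_measurable (fun x => g x * expR (k * g x)) by bmeas.
have b1e : bounded_measurable (fun x => (g1 x - g x) * expR (k * g x)) by bmeas.
pose J := E (fun x => g x * expR (k * g x)).
have -> : E (fun x => k * g x * expR (k * g x)) = k * J.
  by rewrite -expectZ//; under eq_Rintegral do rewrite -mulrA.
have -> : E (fun x => (k1 * g1 x - k * g x) * expR (k * g x)) = k1 * I - (k - k1) * J.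
  rewrite -expectZ// -expectZ// -expectB; bmeas.
  by apply: eq_Rintegral => x _; ring.
have I0 : 0 <= I by apply: expect_ge0 => x; rewrite mulr_ge0 ?expR_ge0// subr_ge0.
move=> ent; rewrite -(ler_pM2l Z0) mulrDr mulrC.
have -> : Z * ((k1 * I - (k - k1) * J) / Z) = k1 * I - (k - k1) * J by field; rewrite gt_eqF.
move=> HW.
rewrite -(ler_pM2l (mulr_gt0 k0 (mulr_gt0 k10 Z0))).
have -> : k * (k1 * Z) * (k^-1 * ln Z) = k1 * (Z * ln Z) by field; rewrite gt_eqF.
have -> : k * (k1 * Z) * (k1^-1 * W) = k * (Z * W) by field; rewrite gt_eqF.
have ck' : (k - k1) * c <= k * k1.
  by rewrite -ler_pdivrMr// mulrAC; have -> : (k - k1) / k1 = k / k1 - 1 by field; rewrite gt_eqF.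
have h1 : (k - k1) * (k * J - Z * ln Z) <= (k - k1) * (c * I).
  by rewrite ler_wpM2l// subr_ge0.
have h2 : (k - k1) * c * I <= k * k1 * I by rewrite ler_wpM2r.
have h3 : k * (ln Z * Z + (k1 * I - (k - k1) * J)) <= k * (Z * W) by rewrite ler_pM2l.
lra.
Qed.

(** Quantitative form of the limit [k -> 0], from [expR u <= 1 + u + 2 u^2] for small [u]. *)
Lemma free_energy_le_expect k M g : bounded_measurable g ->
  (forall x, `|g x| <= M) -> 0 < k -> k * M <= 2^-1 ->
  k^-1 * ln (E (fun x => expR (k * g x))) <= E g + 2 * M ^+ 2 * k.
Proof.
move=> bg gM k0 kM.
rewrite ler_pdivrMl// -[leRHS]expRK ler_ln ?posrE ?expR_gt0//; last first.
  by apply: expect_expR_gt0; bmeas.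
apply: le_trans (expR_ge1Dx _).
have -> : 1 + k * (E g + 2 * M ^+ 2 * k) = E (fun x => k * g x + (1 + 2 * (k * M) ^+ 2)).
  rewrite expectD; bmeas.
  by rewrite expectZ// expect_cst; ring.
apply: expect_le; bmeas => x.
have kgM : `|k * g x| <= k * M by rewrite normrM gtr0_norm// ler_pM2l.
apply: le_trans (le_expR_quad (le_trans kgM kM)) _.
have : (k * g x) ^+ 2 <= (k * M) ^+ 2.
  by rewrite -[leLHS]real_normK ?num_real// ler_sqr ?nnegrE// (le_trans _ kgM).
lra.
Qed.

End expectation.

(** * Inf- and sup-convolutions *)

Section convolutions.
Context (R : realType) (X : completeMetricType R) (alpha : R -> R).
Context (young_alpha : young_function alpha) (delta2_alpha : delta2 alpha)
  (p_gt1 : 1 < young_exponent alpha).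
Let p := young_exponent alpha.
Let ge0 := young_ge0 young_alpha.

Lemma young_mdist_le (x x' y : X) : mdist x x' <= 1 ->
  alpha (mdist x' y) <= alpha (mdist x y) + alpha (mdist x y + 2) * mdist x x'.
Proof.
move=> xx'; have t : mdist x' y <= mdist x y + mdist x x'.
  by rewrite addrC (metric_sym x x') metric_triangle.
have [le|/ltW le] := leP (mdist x' y) (mdist x y).
  apply: ler_wpDr; first by rewrite mulr_ge0// mdist_ge0.
  by apply: young_mono => //; exact: mdist_ge0.
have := @young_lipschitz _ _ young_alpha (mdist x y + 1) _ _ (mdist_ge0 x y) le _.
have -> : mdist x y + 1 + 1 = mdist x y + 2 by ring.
have yr : mdist x' y <= mdist x y + 1 by lra.
move=> /(_ yr); have := ge0 (mdist x y + 2).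
have : mdist x' y - mdist x y <= mdist x x' by lra.
nra.
Qed.

(** For bounded [f] the infimum is finite, so a real function [q] stands for it, described by its
    defining bounds. It is upper semicontinuous, hence measurable: a near-minimiser at [x] is still
    good at nearby points. *)
Lemma inf_convolutionE (lambda M : R) (f : X -> R) : 0 < lambda ->
  (forall x, `|f x| <= M) ->
  exists q : X -> R, [/\ bounded_measurable (q : borel X -> R),
    forall x, inf_convolution alpha lambda f x = (q x)%:E,
    forall x, q x <= f x,
    forall x y, q x <= f y + lambda * alpha (mdist x y) &
    forall c x, (forall y, c <= f y + lambda * alpha (mdist x y)) -> c <= q x].
Proof.
move=> l0 fM.
pose S x := range (fun y : X => f y + lambda * alpha (mdist x y)).
pose q x := inf (S x).
have Slb x : lbound (S x) (- M).
  move=> _ [y _ <-]; have := fM y; rewrite ler_norml => /andP[fy _].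
  by rewrite -[- M]addr0 lerD// mulr_ge0// ltW.
have hS x : has_inf (S x).
  split; last by exists (- M); exact: Slb.
  by exists (f x + lambda * alpha (mdist x x)), x.
have q_le x y : q x <= f y + lambda * alpha (mdist x y).
  by apply: ge_inf; [exact: (hS x).2 | exists y].
have le_q c x : (forall y, c <= f y + lambda * alpha (mdist x y)) -> c <= q x.
  by move=> H; apply: lb_le_inf; [exact: (hS x).1 | move=> _ [y _ <-]].
have qf x : q x <= f x.
  by have := q_le x x; rewrite mdistxx (young0 young_alpha) mulr0 addr0.
exists q; split => //; last first.
  move=> x; rewrite /inf_convolution -ereal_inf_EFin; [|exact: (hS x).2|exact: (hS x).1].
  congr ereal_inf; apply/seteqP; split => [_ [y _ <-]|_ [_ [y _ <-] <-]].
    by exists (f y + lambda * alpha (mdist x y)) => //; exists y.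
  by exists y.
split; last first.
  exists M => x; rewrite ler_norml le_q/=.
    by apply: le_trans (qf x) _; exact: le_trans (ler_norm _) (fM x).
  by move=> y; apply: (Slb x); exists y.
apply: usc_measurable => x a xa.
have [_ [y _ <-] ya] := inf_lt (hS x).1 xa.
pose L := lambda * alpha (mdist x y + 2) + 1.
have L0 : 0 < L by rewrite ltr_wpDl// mulr_ge0// ltW.
pose b := a - (f y + lambda * alpha (mdist x y)).
have b0 : 0 < b by rewrite subr_gt0.
exists (Num.min 1 (b / L)); first by rewrite lt_min ltr01 divr_gt0.
move=> x'; rewrite lt_min => /andP[/ltW xx'1]; rewrite ltr_pdivlMr// => xx'.
apply: le_lt_trans (q_le x' y) _.
have := young_mdist_le y xx'1; have := mdist_ge0 x x'.
move: xx'; rewrite /b /L; nra.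
Qed.

(** Here [t] is the penalty weight: time [T] corresponds to weight [T ^ (- q)] with [q = p - 1]. In
    this variable the function is a supremum of affine functions. *)
Definition sup_convolution (t : R) (h : X -> R) (x : X) : R :=
  sup (range (fun y : X => h y - t * alpha (mdist x y))).

Section sup_convolution.
Context (h : X -> R) (M : R) (hM : forall x, `|h x| <= M).
Local Notation G t := (sup_convolution t h).

Let hle y : h y <= M. Proof. exact: le_trans (ler_norm _) (hM y). Qed.
Let hge y : - M <= h y. Proof. by have := hM y; rewrite ler_norml => /andP[]. Qed.

Let hS t x : 0 < t -> has_sup (range (fun y : X => h y - t * alpha (mdist x y))).
Proof.
move=> t0; split; first by exists (h x - t * alpha (mdist x x)), x.
by exists M => _ [y _ <-]; rewrite lerBlDr ler_wpDr// mulr_ge0// ltW.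
Qed.

Lemma sup_convolution_ge t x y : 0 < t -> h y - t * alpha (mdist x y) <= G t x.
Proof. by move=> t0; apply: ub_le_sup; [exact: (hS x t0).2 | exists y]. Qed.

Lemma sup_convolution_le t x c : 0 < t ->
  (forall y, h y - t * alpha (mdist x y) <= c) -> G t x <= c.
Proof. by move=> t0 H; apply: ge_sup; [exact: (hS x t0).1 | move=> _ [y _ <-]]. Qed.

Lemma le_sup_convolution t x : 0 < t -> h x <= G t x.
Proof.
by move=> /(sup_convolution_ge x x); rewrite mdistxx (young0 young_alpha) mulr0 subr0.
Qed.

Lemma sup_convolution_bound t x : 0 < t -> `|G t x| <= M.
Proof.
move=> t0; rewrite ler_norml (le_trans (hge x) (le_sup_convolution x t0))/=.
by apply: sup_convolution_le => // y; rewrite lerBlDr ler_wpDr// mulr_ge0// ltW.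
Qed.

Lemma sup_convolution_anti s t x : 0 < s -> s <= t -> G t x <= G s x.
Proof.
move=> s0 st; apply: sup_convolution_le; first exact: lt_le_trans st.
move=> y; apply: le_trans (sup_convolution_ge x y s0).
by rewrite lerD2l lerN2 ler_wpM2r.
Qed.

(** A supremum of affine functions of the weight is convex, so the rate of decrease on [[t, t2]] is
    at most that on [[t1, t]]. *)
Lemma sup_convolution_convex t1 t t2 x : 0 < t1 -> t1 < t -> t < t2 ->
  (G t x - G t2 x) * (t - t1) <= (t2 - t) * (G t1 x - G t x).
Proof.
move=> t10 t1t tt2; have t0 : 0 < t by lra.
have t20 : 0 < t2 by lra.
have d0 : 0 < t2 - t1 by lra.
suff : G t x <= ((t - t1) * G t2 x + (t2 - t) * G t1 x) / (t2 - t1).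
  by rewrite ler_pdivlMr//; lra.
apply: sup_convolution_le => // y; rewrite ler_pdivlMr//.
have := sup_convolution_ge x y t10; have := sup_convolution_ge x y t20; nra.
Qed.

(** Beyond the radius [r] the penalty exceeds [2 M], the maximal oscillation of [h], so such points
    do not beat the value at [x']. Within radius [r], the Lipschitz bound on [alpha] applies. *)
Lemma sup_convolution_lipschitz t : 0 < t -> exists2 L : R, 0 <= L &
  forall x x', mdist x x' <= 1 -> `|G t x - G t x'| <= L * mdist x x'.
Proof.
move=> t0; have a1 : 0 < alpha 1 by exact: young_gt0.
have M0 : 0 <= M by exact: le_trans (hM point).
pose r := 1 + 2 * M / (t * alpha 1).
have r1 : 1 <= r by rewrite /r lerDl divr_ge0 ?mulr_ge0// ltW.
have tar : 2 * M <= t * alpha r.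
  apply: (@le_trans _ _ (t * (r * alpha 1))); last first.
    by rewrite ler_pM2l//; exact: young_ge_linear.
  rewrite /r (_ : t * _ = t * alpha 1 + 2 * M); last by field; rewrite !gt_eqF.
  by rewrite lerDr mulr_ge0// ltW.
exists (t * alpha (r + 2)); first by rewrite mulr_ge0// ltW.
suff H x x' : mdist x x' <= 1 -> G t x - G t x' <= t * alpha (r + 2) * mdist x x'.
  move=> x x' xx'; rewrite ler_norml H// andbT.
  by have := H x' x; rewrite (metric_sym x' x) => /(_ xx'); lra.
move=> xx'; rewrite lerBlDr; apply: sup_convolution_le => // y.
have [yr|/ltW ry] := leP (mdist x y) r; last first.
  have rad : alpha r <= alpha (mdist x y) by apply: young_mono => //; lra.
  have := le_sup_convolution x' t0; have := hge x'; have := hle y.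
  have : 0 <= t * alpha (r + 2) * mdist x x'.
    by rewrite !mulr_ge0 ?mdist_ge0// ltW.
  have : t * alpha r <= t * alpha (mdist x y) by rewrite ler_pM2l.
  lra.
have := sup_convolution_ge x' y t0; have := young_mdist_le y xx'.
have : alpha (mdist x y + 2) <= alpha (r + 2).
  by apply: young_mono => //; have := mdist_ge0 x y; lra.
have := mdist_ge0 x x'; have := ge0 (mdist x y + 2).
set d := mdist x x'; set u := alpha (mdist x y + 2); set v := alpha (r + 2).
move=> u0 d0 uv H1 H2.
have H3 : u * d <= v * d by rewrite ler_wpM2r.
have : t * (alpha (mdist x' y)) <= t * (alpha (mdist x y) + v * d).
  by rewrite ler_pM2l//; lra.
lra.
Qed.

(** The supersolution property for a step back from time [T] to [(1 - s) T]: apply the triangle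
    inequality to the penalty and split it with [young_add_weighted]. *)
Lemma sup_convolution_semigroup t s x z : 0 < t -> 0 < s < 1 ->
  G (t * (1 - s) `^ (1 - p)) x <= G t z + t * s `^ (1 - p) * alpha (mdist x z).
Proof.
move=> t0 /[dup] s01 /andP[s0 s1].
have T0 : 0 < t * (1 - s) `^ (1 - p) by rewrite mulr_gt0// powR_gt0; lra.
apply: sup_convolution_le => // y.
have := young_add_weighted young_alpha delta2_alpha p_gt1 s01 (mdist_ge0 x y) (mdist_ge0 x z).
have : alpha (mdist z y) <= alpha (mdist x y + mdist x z).
  apply: young_mono => //; first exact: mdist_ge0.
  by rewrite addrC (metric_sym x z) metric_triangle.
have := sup_convolution_ge z y t0; rewrite -/p.
set a := (1 - s) `^ _; set b := s `^ _ => H1 H2 H3.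
have : t * alpha (mdist z y) <= t * (a * alpha (mdist x y) + b * alpha (mdist x z)).
  by rewrite ler_pM2l//; lra.
lra.
Qed.

Lemma sup_convolution_locally_lipschitz k t : 0 < t ->
  locally_lipschitz (fun x => k * G t x).
Proof.
move=> t0; have [L L0 HL] := sup_convolution_lipschitz t0.
(* Two points of a ball of radius one half are at distance at most [1], the range of [HL]. *)
move=> x; exists 2^-1 => //; exists (`|k| * L) => _ [[y z]/= [+ + zy] <-].
rewrite ballEmdist/= => xy xz.
have yz : mdist y z <= 1.
  by apply: le_trans (metric_triangle y x z) _; rewrite (metric_sym y x); lra.
rewrite ler_pdivrMr; last by rewrite mdist_gt0; apply/eqP => /esym.
by rewrite -mulrBr normrM -mulrA ler_wpM2l// HL.
Qed.

Lemma sup_convolution_bounded_measurable t : 0 < t ->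
  bounded_measurable (G t : borel X -> R).
Proof.
move=> t0; split; last by exists M => x; exact: sup_convolution_bound.
apply: locally_lipschitz_measurable.
by have := @sup_convolution_locally_lipschitz 1 _ t0; under eq_fun do rewrite mul1r.
Qed.

End sup_convolution.
End convolutions.

(** * From the logarithmic Sobolev inequality to an exponential inequality *)

Section tau_LSI_to_exponential_inequality.
Context (R : realType) (X : completeMetricType R) (alpha : R -> R).
Context (young_alpha : young_function alpha) (delta2_alpha : delta2 alpha)
  (p_gt1 : 1 < young_exponent alpha) (mu : probability (borel X) R).
Let p := young_exponent alpha.
Local Notation G h t := (sup_convolution alpha t h).
Local Notation E f := (Rintegral mu setT f).

Lemma bounded_bounded_fun (f : X -> R) M : (forall x, `|f x| <= M) -> bounded_fun f.
Proof.
move=> fM; exists M; split; first exact: num_real.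
by move=> N MN x _ /=; apply: le_trans (fM x) (ltW MN).
Qed.

(** Apply the logarithmic Sobolev inequality to [k G_t h]. The relation between [lambda], [k], [t]
    and [s] turns the semigroup bound into a lower bound for its inf-convolution by [k] times the
    later [G]. *)
Lemma tau_LSI_sup_convolution (h : X -> R) M lambda A k t s :
  (forall x, `|h x| <= M) -> 0 < lambda -> 0 <= A -> tau_LSI alpha mu lambda A ->
  0 < t -> 0 < s < 1 -> 0 < k -> lambda = k * (t * s `^ (1 - p)) ->
  rentropy mu (fun x : borel X => k * G h t x) <=
  A * k * E (fun x : borel X => (G h t x - G h (t * (1 - s) `^ (1 - p)) x) * expR (k * G h t x)).
Proof.
move=> hM l0 A0 lsi t0 s01 k0 lE; set t2 := t * (1 - s) `^ (1 - p).
have t20 : 0 < t2 by rewrite mulr_gt0// powR_gt0//; lra.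
have GM x : `|k * G h t x| <= k * M.
  by rewrite normrM gtr0_norm// ler_pM2l//; exact: (sup_convolution_bound young_alpha hM).
have bG T := sup_convolution_bounded_measurable young_alpha delta2_alpha p_gt1 hM (t := T).
have bf : bounded_measurable (fun x : borel X => k * G h t x).
  by apply: bounded_measurableZ; exact: bG.
have [q [bq qE _ _ q_ge]] := inf_convolutionE young_alpha l0 GM.
have := lsi (fun x => k * G h t x) (bounded_bounded_fun GM)
  (sup_convolution_locally_lipschitz young_alpha delta2_alpha p_gt1 hM k t0).
rewrite (entropy_expR mu bf).
have b1 : bounded_measurable (fun x : borel X => (k * G h t x - q x) * expR (k * G h t x)).
  by bmeas.
rewrite (eq_integral (fun x : borel X => ((k * G h t x - q x) * expR (k * G h t x))%:E)); last first.
  by move=> x _; rewrite qE.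
rewrite (expect_EFin mu b1) -EFinM lee_fin => /le_trans; apply.
have b2 : bounded_measurable (fun x : borel X => (G h t x - G h t2 x) * expR (k * G h t x)).
  by bmeas; apply: bG.
rewrite -mulrA ler_wpM2l// -expectZ//; apply: expect_le => //.
  by apply: bounded_measurableZ.
move=> x; rewrite mulrA ler_wpM2r ?expR_ge0// mulrBr lerD2l lerN2.
apply: q_ge => y; rewrite lE -!mulrA -mulrDr ler_pM2l// mulrA.
exact: (sup_convolution_semigroup young_alpha delta2_alpha p_gt1 hM).
Qed.

(* The schedule is geometric in the odds [w = w0 b^n]: [schedule_t] is the
   penalty [t^(-q)] at the time [t = w / (1 + w)], and [schedule_s] is the
   fraction of [t] by which the logarithmic Sobolev inequality steps back at
   inverse temperature [schedule_k]. *)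
Let q := p - 1.

Let schedule_x (b : R) n := b ^- n.
Let schedule_s b n := schedule_x b n / p.
Let schedule_t (w0 b : R) n := (1 + schedule_x b n / w0) `^ q.
(** The value forced by [lambda = k * (t * s ^ (1 - p))]; the quantity [1 + schedule_x b n / w0] is
    the inverse of the time. *)
Let schedule_k lambda w0 b n :=
  lambda * (schedule_s b n / (1 + schedule_x b n / w0)) `^ q.

(** The Sobolev inequality bounds the entropy by the drop of [G] over [[t n, t2]], and convexity
    bounds that drop by [rho] times the increment to [t n.+1]. Then [free_energy_step] asks for
    [(r ^ q - 1) * A * rho <= 1], which is [odds_step_ineq] after a chord estimate. *)
Lemma free_energy_schedule_step (h : X -> R) M lambda A w0 b n :
  (forall x, `|h x| <= M) -> 0 < lambda -> 0 <= A -> tau_LSI alpha mu lambda A ->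
  0 < w0 -> 1 < b ->
  A * ((p / q) `^ q - 1) * w0 * b `^ p <= 1 ->
  let k := schedule_k lambda w0 b in let t := schedule_t w0 b in
  ((k n)^-1 * ln (E (fun x : borel X => expR (k n * G h (t n) x))) <=
  (k n.+1)^-1 * ln (E (fun x : borel X => expR (k n.+1 * G h (t n.+1) x))) : Prop).
Proof.
move=> hM l0 A0 lsi w00 b1 Bb k t.
have q0 : 0 < q by rewrite subr_gt0.
have p0 : 0 < p by exact: lt_trans p_gt1.
have b0 : 0 < b by lra.
pose x m := schedule_x b m.
have x0 m : 0 < x m by rewrite invr_gt0 exprn_gt0.
have x1 m : x m <= 1 by rewrite invf_le1 ?exprn_gt0// exprn_ege1// ltW.
have xS m : x m = b * x m.+1.
  by rewrite /x /schedule_x exprSr invfM mulrCA mulfV ?mulr1// gt_eqF.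
have k_gt0 m : 0 < k m.
  by rewrite mulr_gt0// powR_gt0// !divr_gt0// addr_gt0// divr_gt0.
have D0 m : 0 < 1 + x m / w0 by rewrite addr_gt0// divr_gt0.
have t_gt0 m : 0 < t m by rewrite powR_gt0.
pose s := schedule_s b n.
have s01 : 0 < s < 1.
  rewrite divr_gt0//= ltr_pdivrMr// mul1r; exact: le_lt_trans p_gt1.
have [s0 s1] : 0 < s /\ s < 1 by apply/andP.
have oneBp : 1 - p = - q by rewrite /q; ring.
pose w := w0 / x n; have w_gt0 : 0 < w by rewrite divr_gt0.
(* In one step [k] is divided by [r ^ q] and the weight [t] is multiplied by [(r / b) ^ q]. *)
pose r := (b * w + 1) / (w + 1).
have r0 : 0 < r by rewrite divr_gt0// addr_gt0// mulr_gt0.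
have xn0 := x0 n.+1.
have rE : r = b * (1 + x n.+1 / w0) / (1 + x n / w0).
  rewrite /r /w xS; field; rewrite !gt_eqF//=.
  by rewrite addr_gt0// mulr_gt0.
have kr : k n = r `^ q * k n.+1.
  rewrite /k /schedule_k mulrCA -powRM ?(ltW r0)//; last first.
    by rewrite !divr_ge0 ?ltW//; exact: D0.
  congr (_ * _ `^ _); rewrite rE /schedule_s -/(x n) -/(x n.+1) xS; field.
  rewrite !gt_eqF//=; first by rewrite addr_gt0// mulr_gt0.
  by rewrite addr_gt0.
have rb0 : 0 < r / b by rewrite divr_gt0.
have tE : t n.+1 = (r / b) `^ q * t n.
  rewrite /t /schedule_t -powRM; [|exact: ltW|exact/ltW/D0].
  congr (_ `^ _); rewrite rE -/(x n) -/(x n.+1) xS; field.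
  by rewrite !gt_eqF//= addr_gt0// mulr_gt0.
have one_q : 1 `^ q = 1 :> R by rewrite powR1.
have rb1 : r / b < 1.
  by rewrite ltr_pdivrMr// mul1r /r ltr_pdivrMr ?addr_gt0//; nra.
have r1 : 1 < r.
  by rewrite /r ltr_pdivlMr ?addr_gt0//; nra.
have rq1 : 1 <= r `^ q by rewrite -(powRr0 r); apply: ler_powR; rewrite ltW.
have t1t : t n.+1 < t n.
  rewrite tE -[ltRHS]mul1r ltr_pM2r// -[ltRHS]one_q.
  by apply: gt0_ltr_powR; rewrite ?nnegrE// ltW.
pose S := (1 - s) `^ (1 - p); pose t2 := t n * S.
have S1 : 1 < S.
  rewrite /S oneBp powRN invf_gt1 ?powR_gt0 ?subr_gt0// -[ltRHS]one_q.
  apply: gt0_ltr_powR; rewrite ?nnegrE//; lra.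
have tt2 : t n < t2 by rewrite /t2 -[ltLHS]mulr1 ltr_pM2l.
have d0 : 0 < t n - t n.+1 by rewrite subr_gt0.
pose rho := (t2 - t n) / (t n - t n.+1).
have rho0 : 0 <= rho by rewrite divr_ge0 ?ltW// subr_gt0.
have lE : lambda = k n * (t n * s `^ (1 - p)).
  rewrite /k /schedule_k /t /schedule_t -/(x n) -/s powR_div ?ltW// oneBp powRN.
  by field; rewrite !gt_eqF// powR_gt0.
have bG T := sup_convolution_bounded_measurable young_alpha delta2_alpha p_gt1 hM (t := T).
have bg := bG _ (t_gt0 n); have bg1 := bG _ (t_gt0 n.+1).
have bg2 := bG _ (lt_trans (t_gt0 n) tt2).
have be := bounded_measurable_expR (bounded_measurableZ (k n) bg).
have bge1 := bounded_measurableM (bounded_measurableB bg1 bg) be.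
have bge2 := bounded_measurableM (bounded_measurableB bg bg2) be.
apply: (@free_energy_step _ _ _ _ _ _ (A * k n * rho)) => //.
- by move=> y; apply: (sup_convolution_anti young_alpha hM) => //; exact: ltW.
- by rewrite kr -[leLHS]mul1r ler_pM2r.
- apply: le_trans (tau_LSI_sup_convolution hM l0 A0 lsi (t_gt0 n) s01 (k_gt0 n) lE) _.
  rewrite -[leRHS]mulrA; apply: ler_wpM2l; first by rewrite mulr_ge0// ltW.
  rewrite -expectZ//; apply: expect_le => //; first exact: bounded_measurableZ.
  move=> y; rewrite mulrA ler_wpM2r ?expR_ge0//.
  rewrite /rho mulrAC ler_pdivlMr//.
  exact: (sup_convolution_convex young_alpha hM).
have kk : k n / k n.+1 - 1 = r `^ q - 1 by rewrite kr mulfK// gt_eqF.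
rewrite kk; pose m := (p / q) `^ q - 1.
have m0 : 0 <= m.
  rewrite subr_ge0 -[leLHS]one_q; apply: ge0_ler_powR; rewrite ?nnegrE ?divr_ge0 ?ltW//.
  by rewrite lter_pdivlMr// mul1r /q; lra.
have pq : p = q + 1 by rewrite /q; ring.
have Bge0 : 0 <= A * m * w0 by rewrite !mulr_ge0// ltW.
have Bb' : A * m * w0 * b `^ (q + 1) <= 1 by rewrite -pq.
have := odds_step_ineq q0 w_gt0 b1 Bge0 Bb' erefl; rewrite -/r.
have -> : A * m * w0 / w = A * (x n * m) by rewrite /w; field; rewrite !gt_eqF.
move=> main.
(* The chord replaces the nonlinear [S - 1] by a multiple of [x n], which matches the factor [1 / w]
   in [odds_step_ineq]. *)
have chord : S - 1 <= x n * m.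
  have := @powRN_le_chord _ q (x n) q0; rewrite ltW//= x1// => /(_ isT).
  by rewrite -pq -/m -/s -oneBp -/S; lra.
have -> : (r `^ q - 1) * (A * k n * rho) = k n * ((r `^ q - 1) * (A * (S - 1)) * t n / (t n - t n.+1)).
  by rewrite /rho /t2; field; rewrite gt_eqF.
rewrite -[leRHS]mulr1 ler_pM2l// ler_pdivrMr// mul1r.
have -> : t n - t n.+1 = (1 - (r / b) `^ q) * t n by rewrite tE; ring.
rewrite ler_pM2r//.
apply: le_trans main; apply: ler_wpM2l; first by rewrite subr_ge0.
exact: ler_wpM2l.
Qed.

(** The integrand on the right is nonnegative, because [y = x] competes in the infimum. *)
Lemma tau_LSI_weaken lambda A B : A <= B ->
  tau_LSI alpha mu lambda A -> tau_LSI alpha mu lambda B.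
Proof.
move=> AB lsi f bf lf; apply: le_trans (lsi f bf lf) _.
apply: lee_wpmul2r; last by rewrite lee_fin.
apply: integral_ge0 => x _; apply: mule_ge0; last by rewrite lee_fin expR_ge0.
have le_f : (inf_convolution alpha lambda f x <= (f x)%:E)%E.
  apply: ereal_inf_lbound; exists x => //.
  by rewrite mdistxx (young0 young_alpha) mulr0 addr0.
by rewrite sube_ge0 ?fin_numE ?orbT//.
Qed.

(** The exponents combine by [q + q^2 = p q]; in this form the constant meets the condition on the
    starting point of the schedule. *)
Lemma kappa_powR : kappa p = (p * (p / q) `^ q) `^ q.
Proof.
have q0 : 0 < q by rewrite subr_gt0.
have p0 : 0 < p by exact: lt_trans p_gt1.
rewrite /kappa -/q powRM ?powR_ge0 ?(ltW p0)// -powRrM powR_div ?ltW//.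
rewrite mulrA -powRD ?(gt_eqF p0) ?implybT//; congr (_ `^ _ / _); rewrite /q; ring.
Qed.

(** The schedule starts at [k0], where [h <= G h t] bounds the left side by [F 0]. [F] is
    nondecreasing, and [t n >= 1] gives [G h (t n) <= G h 1]. As [k n] tends to [0], the free energy
    of [G h 1] is at most its mean up to an error of order [k n]. *)
Lemma exponential_inequality (h : X -> R) M lambda A k0 :
  bounded_measurable (h : borel X -> R) -> (forall x, `|h x| <= M) ->
  0 < lambda -> tau_LSI alpha mu lambda A ->
  0 < k0 -> k0 * (1 / lambda * kappa p * Num.max A 1 `^ (p - 1)) < 1 ->
  (k0^-1 * ln (E (fun x : borel X => expR (k0 * h x))) <= E (G h 1) : Prop).
Proof.
move=> bh hM l0 lsi0 k00 k0C.
have q0 : 0 < q by rewrite subr_gt0.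
have p0 : 0 < p by exact: lt_trans p_gt1.
have pq : p = q + 1 by rewrite /q; ring.
pose A' := Num.max A 1; have A'1 : 1 <= A' by rewrite /A' le_max lexx orbT.
have A'0 : 0 < A' by lra.
have lsi : tau_LSI alpha mu lambda A'.
  by apply: tau_LSI_weaken lsi0; rewrite /A' le_max lexx.
pose K := (p / q) `^ q.
have one_q : 1 `^ q = 1 :> R by rewrite powR1.
have K1 : 1 < K.
  rewrite /K -[ltLHS]one_q.
  by apply: gt0_ltr_powR; rewrite ?nnegrE ?divr_ge0 ?ltW// ltr_pdivlMr// mul1r pq ltrDl.
pose s0 := (k0 / lambda) `^ q^-1.
have s00 : 0 < s0 by rewrite powR_gt0// divr_gt0.
have s0q : s0 `^ q = k0 / lambda.
  by rewrite -powRrM mulVf ?gt_eqF// powRr1// divr_ge0// ltW.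
have small : s0 * (p * K) * A' < 1.
  rewrite ltNge; apply/negP => big.
  move: k0C; rewrite ltNge => /negP; apply.
  have -> : k0 * (1 / lambda * kappa p * Num.max A 1 `^ (p - 1)) =
      (s0 * (p * K) * A') `^ q.
    have pK0 : 0 <= p * K by rewrite mulr_ge0 ?powR_ge0// ltW.
    rewrite kappa_powR -/K -/A' -/q (powRM _ (mulr_ge0 (ltW s00) pK0) (ltW A'0)).
    rewrite [in RHS](powRM _ (ltW s00) pK0) s0q.
    by field; rewrite gt_eqF.
  by rewrite -(powRr0 (s0 * (p * K) * A')); apply: ler_powR => //; exact: ltW.
(* [t0] is the starting time and [w0] below its odds: the first backward fraction is [1 / p], so the
   first inverse temperature is [lambda * (t0 / p) ^ q = k0]. *)
pose t0 := p * s0; have t00 : 0 < t0 by rewrite mulr_gt0.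
have t0K : t0 * K * A' < 1 by move: small; rewrite /t0; lra.
have t01 : t0 < 1.
  apply: le_lt_trans t0K; rewrite -mulrA -[leLHS]mulr1 ler_pM2l//.
  by rewrite mulr_ege1// ltW.
pose m := K - 1; have m0 : 0 < m by rewrite subr_gt0.
pose w0 := t0 / (1 - t0); have w00 : 0 < w0 by rewrite divr_gt0// subr_gt0.
pose B := A' * m * w0; have B0 : 0 < B by apply: mulr_gt0 => //; exact: mulr_gt0.
(* This reads [A' * (K - 1) * t0 < 1 - t0]; since [A' >= 1], it follows from [t0 * K * A' < 1]. *)
have B1 : B < 1.
  rewrite /B /w0 mulrA ltr_pdivrMr ?subr_gt0// mul1r /m.
  have : t0 * 1 <= t0 * A' by rewrite ler_pM2l.
  move: t0K; lra.
(* The largest ratio the schedule admits: [B * b ^ p = 1], and [b > 1] because [B < 1]. *)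
pose b := B `^ (- p^-1).
have b0 : 0 < b by rewrite powR_gt0.
have bp : b `^ p = B^-1.
  by rewrite -powRrM mulNr mulVf ?gt_eqF// powR_inv1// ltW.
have b1 : 1 < b.
  rewrite ltNge; apply/negP => b1.
  have : b `^ p <= 1 `^ p by apply: ge0_ler_powR; rewrite ?nnegrE// ltW.
  by rewrite bp powR1 invf_le1// leNgt B1.
have Bb : A' * (K - 1) * w0 * b `^ p <= 1 by rewrite bp -/m -/B mulfV// gt_eqF.
pose k := schedule_k lambda w0 b; pose t := schedule_t w0 b.
pose F n := (k n)^-1 * ln (E (fun x : borel X => expR (k n * G h (t n) x))).
have F_nd : forall n, F 0%N <= F n.
  have nd (u : nat -> R) : (forall n, u n <= u n.+1) -> forall n, u 0%N <= u n.
    by move=> uS; elim=> // n ih; exact: le_trans ih (uS n).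
  apply: nd => n.
  exact: (free_energy_schedule_step n hM l0 (ltW A'0) lsi w00 b1 Bb).
have x0 m' : 0 < schedule_x b m' by rewrite invr_gt0 exprn_gt0.
have D1 n : 1 <= 1 + schedule_x b n / w0 by rewrite lerDl divr_ge0// ltW.
have D0 n : 0 < 1 + schedule_x b n / w0 by exact: lt_le_trans (D1 n).
have k_gt0 n : 0 < k n by rewrite mulr_gt0// powR_gt0// !divr_gt0.
have t1 n : 1 <= t n by rewrite -(powRr0 (1 + schedule_x b n / w0)); apply: ler_powR => //; exact: ltW.
have t_gt0 n : 0 < t n by exact: lt_le_trans (t1 n).
have k0E : k 0%N = k0.
  rewrite /k /schedule_k /schedule_s /schedule_x expr0 invr1.
  have -> : 1 / p / (1 + 1 / w0) = s0.
    have d0 : 0 < 1 - t0 by rewrite subr_gt0.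
    have -> : 1 + 1 / w0 = t0^-1 by rewrite /w0; field; rewrite !gt_eqF.
    by rewrite /t0; field; rewrite !gt_eqF.
  by rewrite s0q; field; rewrite gt_eqF.
have bG T := sup_convolution_bounded_measurable young_alpha delta2_alpha p_gt1 hM (t := T).
have bZ T c : 0 < T -> bounded_measurable (fun x : borel X => c * G h T x).
  by move=> T0; apply: bounded_measurableZ; exact: bG.
have le_ln (f g : borel X -> R) : bounded_measurable f -> bounded_measurable g ->
    (forall x, f x <= g x) -> ln (E (fun x => expR (f x))) <= ln (E (fun x => expR (g x))).
  move=> bf bg fg; rewrite ler_ln ?posrE; try exact: expect_expR_gt0.
  by apply: expect_le; [bmeas|bmeas|move=> x; rewrite ler_expR].
have start : k0^-1 * ln (E (fun x : borel X => expR (k0 * h x))) <= F 0%N.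
  rewrite /F k0E ler_pM2l ?invr_gt0//; apply: le_ln; [exact: bounded_measurableZ|exact: bZ|].
  by move=> x; rewrite ler_pM2l//; exact: (le_sup_convolution young_alpha hM).
have M0 : 0 <= M by exact: le_trans (hM point).
have finish n : k n * M <= 2^-1 -> F n <= E (G h 1) + 2 * M ^+ 2 * k n.
  move=> kM; apply: le_trans (free_energy_le_expect mu (bG 1 ltr01) _ (k_gt0 n) kM).
    apply: ler_wpM2l; first by rewrite invr_ge0 ltW.
    apply: le_ln; [exact: bZ|exact: bZ|move=> x].
    apply: ler_wpM2l; first exact: ltW.
    exact: (sup_convolution_anti young_alpha hM).
  by move=> x; exact: (sup_convolution_bound young_alpha hM).
have k_small e : 0 < e -> exists n, k n <= e.
  move=> e0; pose c := (b^-1) `^ q.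
  have c01 : 0 <= c < 1.
    rewrite powR_ge0/= -[ltRHS]one_q.
    by apply: gt0_ltr_powR; rewrite ?nnegrE ?invr_ge0 ?invf_lt1 ?(ltW b0).
  have kc n : k n <= lambda * c ^+ n.
    rewrite ler_pM2l// -powR_mulrn ?powR_ge0// powRAC powR_mulrn ?invr_ge0 ?(ltW b0)//.
    apply: ge0_ler_powR; rewrite ?nnegrE ?(ltW q0)//.
    - by rewrite !divr_ge0// ltW.
    - by rewrite exprn_ge0// invr_ge0 ltW.
    rewrite ler_pdivrMr// exprVn; apply: (@le_trans _ _ (schedule_x b n)).
      by rewrite ler_pdivrMr// -[leLHS]mulr1 ler_pM2l// ltW.
    by rewrite -[leLHS]mulr1 ler_pM2l.
  have : (lambda * c ^+ n) @[n --> \oo] --> lambda * 0.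
    apply: cvgMr; apply: cvg_expr; rewrite ger0_norm//; by case/andP: c01.
  rewrite mulr0 => /cvgrPdist_le/(_ e e0)[N _ /(_ N (leqnn N))] /=.
  rewrite sub0r normrN ger0_norm; last by rewrite mulr_ge0 ?exprn_ge0 ?powR_ge0 ?ltW.
  by move=> le; exists N; apply: le_trans (kc N) _.
clearbody F; clearbody k.
apply/ler_addgt0Pr => e e0.
(* The first bound makes the error [2 M^2 k] at most [e]; the second puts [k] in the range of the
   quadratic estimate. *)
pose e' := Num.min (e / (2 * M ^+ 2 + 1)) (2^-1 / (M + 1)).
have d1 : 0 < 2 * M ^+ 2 + 1 by rewrite ltr_wpDl// mulr_ge0// sqr_ge0.
have d2 : 0 < M + 1 by rewrite ltr_wpDl.
have [|n] := k_small e'; first by rewrite lt_min !divr_gt0// invr_gt0.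
rewrite le_min !ler_pdivlMr// => /andP[kn1 kn2].
apply: le_trans start _; apply: le_trans (F_nd n) _.
apply: le_trans (finish n _) _.
  by apply: le_trans kn2; rewrite ler_pM2l// lerDl.
by rewrite lerD2l; apply: le_trans kn1; rewrite mulrC ler_pM2l// lerDl.
Qed.

(** The constraint on the pair says exactly that [G h 1 <= f]. *)
Lemma exponential_duality (h f : X -> R) lambda A k0 :
  bounded_measurable (h : borel X -> R) -> bounded_measurable (f : borel X -> R) ->
  0 < lambda -> tau_LSI alpha mu lambda A ->
  0 < k0 -> k0 * (1 / lambda * kappa p * Num.max A 1 `^ (p - 1)) < 1 ->
  (forall x y, h x - f y <= alpha (mdist x y)) ->
  ln (E (fun x : borel X => expR (k0 * h x))) <= k0 * E f.
Proof.
move=> bh bf l0 lsi k00 k0C hf; have [_ [M hM]] := bh.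
rewrite -ler_pdivrMl//; apply: le_trans (exponential_inequality bh hM l0 lsi k00 k0C) _.
apply: expect_le => //.
  exact: (sup_convolution_bounded_measurable young_alpha delta2_alpha p_gt1 hM).
move=> y; apply: (sup_convolution_le young_alpha hM) => // x.
by rewrite mul1r metric_sym; have := hf x y; lra.
Qed.

End tau_LSI_to_exponential_inequality.

(** * Densities and relative entropy *)

Section density.
Context d (T : measurableType d) (R : realType) (mu : probability T R).

Definition has_density (nu : set T -> \bar R) (w : T -> R) :=
  [/\ measurable_fun setT w, forall x, 0 <= w x &
      forall A, measurable A -> nu A = (\int[mu]_(x in A) (w x)%:E)%E].

Section density_measure.
Context (w : T -> R) (mw : measurable_fun setT w) (w0 : forall x, 0 <= w x)
  (w1 : (\int[mu]_x (w x)%:E = 1)%E).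

Let nu A := (\int[mu]_(x in A) (w x)%:E)%E.

Let nu0 : nu set0 = 0%E. Proof. exact: integral_set0. Qed.

Let nu_ge0 A : (0 <= nu A)%E.
Proof. by apply: integral_ge0 => x _; rewrite lee_fin. Qed.

Let nu_sigma : semi_sigma_additive nu.
Proof.
apply: semi_sigma_additive_nng_induced; first exact/measurable_EFinP.
by move=> x; rewrite lee_fin.
Qed.

HB.instance Definition _ := isMeasure.Build _ _ _ nu nu0 nu_ge0 nu_sigma.
HB.instance Definition _ := Measure_isProbability.Build _ _ _ nu w1.

Lemma probability_of_density : exists nu : probability T R, has_density nu w.
Proof. by exists (nu : probability T R). Qed.

End density_measure.

Lemma density_dominates (nu : probability T R) w : has_density nu w -> nu `<< mu.
Proof.
move=> [mw w0 nuE]; apply/null_content_dominatesP => A mA muA.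
by rewrite nuE// null_set_integral//; exact/measurable_funTS/measurable_EFinP.
Qed.

Lemma exists_density (nu : probability T R) : nu `<< mu -> exists w, has_density nu w.
Proof.
move=> numu; have [f [f0 ffin fint fE]] := radon_nikodym_sigma_finite numu.
exists (fine \o f); split.
- by apply: measurableT_comp => //; exact: measurable_int fint.
- by move=> x; exact: fine_ge0.
- by move=> A mA; rewrite fE//; apply: eq_integral => x _; rewrite /= fineK.
Qed.

Lemma integral_density (nu : probability T R) w (g : T -> \bar R) :
  has_density nu w -> measurable_fun setT g -> (forall x, 0 <= g x)%E ->
  (\int[nu]_x g x = \int[mu]_x (g x * (w x)%:E))%E.
Proof.
move=> nuw mg g0; have [mw w0 nuE] := nuw; have numu := density_dominates nuw.
rewrite -(Radon_Nikodym_SigmaFinite.change_of_variables numu g0 measurableT mg).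
have fint := Radon_Nikodym_SigmaFinite.f_integrable numu.
apply: ae_eq_integral => //.
- by apply: emeasurable_funM => //; exact: measurable_int fint.
- by apply: emeasurable_funM => //; exact/measurable_EFinP.
apply: ae_eqe_mul2l; apply: integral_ae_eq => //; first exact/measurable_EFinP.
by move=> A _ mA; rewrite -Radon_Nikodym_SigmaFinite.f_integral//; exact: nuE.
Qed.

Lemma density_gt0_ae (nu : probability T R) w :
  has_density nu w -> nu [set x | w x <= 0] = 0%E.
Proof.
move=> [mw w0 nuE].
have mN : measurable [set x | w x <= 0].
  by rewrite -[X in measurable X]setTI; exact: measurable_fun_le.
rewrite [LHS]nuE// integral0_eq// => x /= wx.
by apply/eqP; rewrite eqe eq_le wx w0.
Qed.

(** The two densities agree [nu]-almost everywhere by domination, and [ln] and [lne] differ only at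
    nonpositive values, which are taken on a [nu]-null set. *)
Lemma relative_entropy_density (nu : probability T R) w : has_density nu w ->
  relative_entropy nu mu = (\int[nu]_x (ln (w x))%:E)%E.
Proof.
move=> nuw; have [mw w0 nuE] := nuw; have numu := density_dominates nuw.
rewrite /relative_entropy asboolT//.
set r := Radon_Nikodym _ _.
have rfin x : r x \is a fin_num by exact: Radon_Nikodym_fin_num.
have rint : mu.-integrable setT r by exact: Radon_Nikodym_integrable.
have mr : measurable_fun setT (fine \o r).
  by apply: measurableT_comp => //; exact: measurable_int rint.
have rw : ae_eq nu setT r (EFin \o w).
  apply: (null_dominates_ae_eq measurableT numu).
  apply: integral_ae_eq => //; first exact/measurable_EFinP.
  by move=> A _ mA; rewrite -Radon_Nikodym_integral//; exact: nuE.
apply: ae_eq_integral => //.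
- have -> : (fun x => lne (r x)) =
      (fun x => if fine (r x) <= 0 then -oo%E else (ln (fine (r x)))%:E).
    by apply/funext => x; rewrite -{1}[r x]fineK.
  apply: measurable_fun_ifT => //; first exact: measurable_fun_ler.
  by apply/measurable_EFinP; exact: measurableT_comp.
- by apply/measurable_EFinP; exact: measurableT_comp.
have Nw : {ae nu, forall x, setT x -> 0 < w x}.
  exists [set x | w x <= 0]; split.
  - by rewrite -[X in measurable X]setTI; exact: measurable_fun_le.
  - exact: density_gt0_ae.
  - by move=> x /= /not_implyP[_ /negP]; rewrite -leNgt.
apply: filterS2 rw Nw => x /= + + _ => /(_ Logic.I) -> /(_ Logic.I) wx.
by rewrite lne_EFin.
Qed.

(** The Donsker-Varadhan inequality. With [e = expR f / (Z w)], the tangent of the exponential gives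
    [ln w >= f - ln Z + 1 - e], and the [nu]-integral of [e] is at most [1]. *)
Lemma relative_entropy_ge (nu : probability T R) (f : T -> R) :
  bounded_measurable f ->
  ((Rintegral nu setT f - ln (Rintegral mu setT (fun x => expR (f x))))%:E
     <= relative_entropy nu mu)%E.
Proof.
move=> bf; have [numu|nnumu] := pselect (nu `<< mu); last first.
  by rewrite /relative_entropy asboolF// leey.
have [w nuw] := exists_density numu; have [mw w0 nuE] := nuw.
rewrite (relative_entropy_density nuw).
set Z := Rintegral mu _ _; have Z0 : 0 < Z by exact: expect_expR_gt0.
(* [u] is [w] with zeros replaced by [1], so that it can be divided by; [ln] is unchanged because
   [ln 0 = 0]. *)
pose u x := if 0 < w x then w x else 1.
have mu_ : measurable_fun setT u.
  by apply: measurable_fun_ifT => //; exact: measurable_fun_ltr.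
have u0 x : 0 < u x by rewrite /u; case: (ltP 0 (w x)) => // _; exact: ltr01.
have lnu x : ln (u x) = ln (w x).
  by rewrite /u; case: (ltP 0 (w x)) => // wx; rewrite ln1 ln0.
pose e x := expR (f x) / Z / u x.
have e0 x : 0 <= e x by rewrite !divr_ge0 ?expR_ge0 ?ltW.
have [mf _] := bf.
have me : measurable_fun setT e.
  apply: measurable_funM; first by apply: measurable_funM => //; exact: measurableT_comp.
  rewrite (_ : (fun x => (u x)^-1) = (fun x => u x `^ (-1))); last first.
    by apply/funext => x; rewrite powR_inv1// ltW.
  exact: (measurableT_comp (measurable_powR (-1)) mu_).
have be : bounded_measurable (fun x => expR (f x)) by exact: bounded_measurable_expR.
have inte1 : (\int[nu]_x (e x)%:E <= 1)%E.
  rewrite (integral_density nuw)//; [|exact/measurable_EFinP].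
  apply: (@le_trans _ _ (\int[mu]_x (Z^-1 * expR (f x))%:E)%E); last first.
    rewrite (expect_EFin mu (bounded_measurableZ _ be)) expectZ// mulVf// gt_eqF//.
  apply: ge0_le_integral => //.
  - by move=> x _; rewrite mule_ge0// lee_fin.
  - by apply: emeasurable_funM; exact/measurable_EFinP.
  - by apply/measurable_EFinP; have [] := bounded_measurableZ Z^-1 be.
  move=> x _; rewrite -EFinM lee_fin.
  have -> : e x * w x = Z^-1 * (expR (f x) * (w x / u x)).
    by rewrite /e; field; rewrite !gt_eqF.
  rewrite ler_wpM2l ?invr_ge0 ?(ltW Z0)//.
  rewrite -[leRHS]mulr1 ler_wpM2l ?expR_ge0// ler_pdivrMr// mul1r /u.
  by case: (ltP 0 (w x)) => // wx; exact: le_trans wx ler01.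
have inte : nu.-integrable setT (EFin \o e).
  apply/integrableP; split; first exact/measurable_EFinP.
  rewrite (eq_integral (EFin \o e)); last by move=> x _; rewrite /= ger0_norm.
  by apply: le_lt_trans inte1 _; rewrite ltry.
pose L x := f x - ln Z + 1 - e x.
have Lle x : L x <= ln (w x).
  rewrite /L -lnu; have -> : e x = expR (f x - ln Z - ln (u x)).
    by rewrite !expRD !expRN !lnK ?posrE.
  by have := expR_ge1Dx (f x - ln Z - ln (u x)); lra.
have bL1 : bounded_measurable (fun x => f x - ln Z + 1).
  by apply: bounded_measurableD; [apply: bounded_measurableB => //|];
    exact: bounded_measurable_cst.
have intL : nu.-integrable setT (EFin \o L).
  rewrite (_ : EFin \o L = (EFin \o (fun x => f x - ln Z + 1)%R) \- (EFin \o e))%E.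
    by apply: integrableB => //; exact: bounded_measurable_integrable.
  by apply/funext => x /=; rewrite /L EFinB.
apply: (@le_trans _ _ (\int[nu]_x (L x)%:E)%E).
  under eq_integral do rewrite /L EFinB.
  rewrite integralB_EFin//; last exact: bounded_measurable_integrable.
  rewrite expect_EFin// expectD ?expectB ?expect_cst; try by
    [|exact: bounded_measurable_cst|apply: bounded_measurableB => //; exact: bounded_measurable_cst].
  rewrite -[leLHS]adde0 -[X in (_ + X)%E](@subee _ 1%:E)// addeA -EFinD.
  by rewrite [leLHS](EFinB _ 1); exact: leeB.
have mlnw : measurable_fun setT (fun x => ln (w x)) by exact: measurableT_comp.
have [intw|nintw] := pselect (nu.-integrable setT (EFin \o (fun x => ln (w x)))).
  by apply: le_integral => // x _; rewrite lee_fin.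
(* If [ln w] is not integrable, its negative part still is, since [L <= ln w]; hence the positive
   part has infinite integral and the entropy is infinite. *)
have neg_fin : (\int[nu]_x ((EFin \o (fun x => ln (w x)))^\- x) < +oo)%E.
  apply: le_lt_trans (integral_funeneg_lt_pinfty measurableT intL).
  apply: ge0_le_integral => //.
  - by apply: measurable_funeneg; exact/measurable_EFinP.
  - by apply: measurable_funeneg; exact: measurable_int intL.
  by move=> x _; rewrite !funenegE/= ge_max !le_max !lee_fin lexx orbT andbT lerN2 Lle.
have pos_oo : (\int[nu]_x ((EFin \o (fun x => ln (w x)))^\+ x) = +oo)%E.
  apply: contrapT => /eqP; rewrite -ltey => pos_fin; apply: nintw.
  apply/integrableP; split; first exact/measurable_EFinP.
  rewrite (eq_integral ((EFin \o (fun x => ln (w x)))^\+ \+ (EFin \o (fun x => ln (w x)))^\-)%E).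
    rewrite ge0_integralD//; first exact: lte_add_pinfty.
    - by apply: measurable_funepos; exact/measurable_EFinP.
    - by apply: measurable_funeneg; exact/measurable_EFinP.
  by move=> x _; exact: (congr1 (@^~ x) (fune_abse (EFin \o (fun x => ln (w x))))).
rewrite [leRHS]integralE pos_oo addye ?leey//.
by rewrite -ltNye -lteN2/= oppeK.
Qed.

End density.

(** * Couplings from partitions *)

Section partition_coupling.
Context d (T : measurableType d) (R : realType) (I : finType) (iota : T -> I).
Context (miota : forall i, measurable (iota @^-1` [set i])).
Implicit Types P nu mu : probability T R.

Local Notation cell i := (iota @^-1` [set i]).

Lemma step_indic_sum (F : I -> R) x : F (iota x) = \sum_i F i * \1_(cell i) x.
Proof.
rewrite (bigD1 (iota x))//= big1 ?addr0; last first.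
  by move=> i /negbTE ne; rewrite indicE memNset ?mulr0//= => E; rewrite E eqxx in ne.
by rewrite indicE mem_set// mulr1.
Qed.

Lemma measurable_step (F : I -> R) : measurable_fun setT (fun x => F (iota x)).
Proof.
under eq_fun do rewrite step_indic_sum.
by apply: measurable_sum => i; apply: measurable_funM => //; exact: measurable_indic.
Qed.

Lemma bounded_measurable_step (F : I -> R) : bounded_measurable (fun x => F (iota x)).
Proof.
split; first exact: measurable_step.
exists (\sum_i `|F i|) => x; rewrite (bigD1 (iota x))//= lerDl.
exact: sumr_ge0.
Qed.

Lemma integral_step P (F : I -> R) : (forall i, 0 <= F i) ->
  (\int[P]_x (F (iota x))%:E = (\sum_i F i * fine (P (cell i)))%:E)%E.
Proof.
move=> F0; under eq_integral do rewrite step_indic_sum -sumEFin.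
rewrite ge0_integral_sum//; last 2 first.
- by move=> i; apply/measurable_EFinP/measurable_funM => //; exact: measurable_indic.
- by move=> i x _; rewrite lee_fin mulr_ge0// indicE.
rewrite -sumEFin; apply: eq_bigr => i _.
rewrite (integralZl_indic measurableT (fun=> cell i))//; last by rewrite ltNge F0.
by rewrite integral_indic// setIT EFinM fineK// fin_num_measure.
Qed.

Lemma sum_cell P : \sum_i fine (P (cell i)) = 1.
Proof.
have := integral_step P (fun=> ler01); under [in RHS]eq_bigr do rewrite mul1r.
have PT : ((P : {measure set T -> \bar R}) setT = 1)%E := probability_setT P.
by rewrite integral_cst// PT mule1 => -[].
Qed.

Lemma Rintegral_step P (F : I -> R) :
  Rintegral P setT (fun x => F (iota x)) = \sum_i fine (P (cell i)) * F i.
Proof.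
pose M := \sum_i `|F i|.
have FM i : 0 <= F i + M.
  have : `|F i| <= M by rewrite /M (bigD1 i)//= lerDl; exact: sumr_ge0.
  by rewrite ler_norml => /andP[]; lra.
have bF := bounded_measurable_step F.
have := integral_step P FM.
have bFM : bounded_measurable (fun x => F (iota x) + M).
  by apply: bounded_measurableD => //; exact: bounded_measurable_cst.
rewrite (expect_EFin P bFM) expectD ?expect_cst//; last exact: bounded_measurable_cst.
under eq_bigr do rewrite mulrDl; rewrite big_split/= -mulr_sumr sum_cell mulr1.
by move=> [] /addIr ->; apply: eq_bigr => i _; rewrite mulrC.
Qed.

Lemma step2_indic_sum (F : I -> I -> R) (z : T * T) :
  F (iota z.1) (iota z.2) = \sum_(k : I * I) F k.1 k.2 * \1_(cell k.1 `*` cell k.2) z.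
Proof.
rewrite (bigD1 (iota z.1, iota z.2))//= big1 ?addr0; last first.
  move=> [i j] ne /=; rewrite indicE memNset ?mulr0//= => -[E1 E2].
  by move: ne; rewrite -E1 -E2 eqxx.
by rewrite indicE mem_set// mulr1.
Qed.

Lemma measurable_cell2 i j : measurable (cell i `*` cell j).
Proof. exact: measurableX. Qed.

Lemma measurable_step2 (F : I -> I -> R) :
  measurable_fun setT (fun z : T * T => F (iota z.1) (iota z.2)).
Proof.
under eq_fun do rewrite step2_indic_sum.
apply: measurable_sum => k; apply: measurable_funM => //.
by apply: measurable_indic; exact: measurable_cell2.
Qed.

Lemma integral_step2 nu mu (F : I -> I -> R) A B : measurable A -> measurable B ->
  (forall i j, 0 <= F i j) ->
  (\int[nu \x mu]_(z in A `*` B) (F (iota z.1) (iota z.2))%:E =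
   (\sum_i \sum_j F i j * (fine (nu (A `&` cell i)) * fine (mu (B `&` cell j))))%:E)%E.
Proof.
move=> mA mB F0.
have mAB : measurable (A `*` B) by exact: measurableX.
under eq_integral do rewrite step2_indic_sum -sumEFin.
rewrite ge0_integral_sum//; last 2 first.
- move=> k; apply/measurable_EFinP/measurable_funM => //.
  by apply: measurable_indic; exact: measurable_cell2.
- by move=> k x _; rewrite lee_fin mulr_ge0// indicE.
rewrite pair_big/= -sumEFin; apply: eq_bigr => -[i j] _ /=.
rewrite (integralZl_indic mAB (fun=> cell i `*` cell j))//; last first.
- exact: measurable_cell2.
- by rewrite ltNge F0.
rewrite integral_indic//; last exact: measurable_cell2.
rewrite EFinM; congr (_ * _)%E.
rewrite (_ : _ `&` _ = (A `&` cell i) `*` (B `&` cell j)); last first.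
  by apply/seteqP; split => -[x y] /=; tauto.
have mAi : measurable (A `&` cell i) by exact: measurableI.
have mBj : measurable (B `&` cell j) by exact: measurableI.
rewrite EFinM !fineK ?fin_num_measure//.
exact: (product_measure1E nu mu mAi mBj).
Qed.

Lemma sum_setI_cell P A : measurable A ->
  \sum_i fine (P (A `&` cell i)) = fine (P A).
Proof.
move=> mA; have mAi i : measurable (A `&` cell i) by exact: measurableI.
have -> : P A = (\sum_i P (A `&` cell i))%E.
  transitivity (\int[P]_x (\1_A x)%:E)%E; first by rewrite integral_indic// setIT.
  transitivity (\int[P]_x (\sum_i (\1_(A `&` cell i) x)%:E))%E.
    apply: eq_integral => x _; rewrite sumEFin; congr EFin.
    rewrite [LHS](step_indic_sum (fun=> \1_A x) x).
    by apply: eq_bigr => i _; rewrite indicI.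
  rewrite ge0_integral_sum//; last first.
    by move=> i; apply/measurable_EFinP/measurable_indic.
  by apply: eq_bigr => i _; rewrite integral_indic// setIT.
rewrite [in RHS](eq_bigr (fun i => (fine (P (A `&` cell i)))%:E)) ?sumEFin//.
by move=> i _; rewrite fineK// fin_num_measure.
Qed.

(** On each product of cells take the multiple of the product measure that has mass [p i j]. The
    marginals are then exact on all measurable sets, because within a cell each one is proportional
    to [nu] or [mu]. *)
Lemma exists_coupling_with_cells nu mu (p : I -> I -> R) :
  (forall i j, 0 <= p i j) ->
  (forall i, \sum_j p i j = fine (nu (cell i))) ->
  (forall j, \sum_i p i j = fine (mu (cell j))) ->
  exists pi : probability (T * T)%type R,
    (forall A, measurable A ->
      pushforward pi fst A = nu A /\ pushforward pi snd A = mu A) /\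
    forall c : I -> I -> R, (forall i j, 0 <= c i j) ->
      (\int[pi]_z (c (iota z.1) (iota z.2))%:E = (\sum_i \sum_j p i j * c i j)%:E)%E.
Proof.
move=> p0 prow pcol.
pose a i := fine (nu (cell i)); pose b j := fine (mu (cell j)).
have a0 i : 0 <= a i by exact: fine_ge0.
have b0 j : 0 <= b j by exact: fine_ge0.
pose W i j := p i j / (a i * b j).
have W0 i j : 0 <= W i j by rewrite divr_ge0// mulr_ge0.
have p_le_a i j : p i j <= a i.
  by rewrite /a -prow (bigD1 j)//= lerDl; exact: sumr_ge0.
have p_le_b i j : p i j <= b j.
  by rewrite /b -pcol (bigD1 i)//= lerDl; exact: sumr_ge0.
(* Division by zero is harmless: [p i j] vanishes as soon as [a i] or [b j] does. *)
have Wab i j : W i j * (a i * b j) = p i j.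
  have [ab0|ab0] := eqVneq (a i * b j) 0; last by rewrite divfK.
  rewrite ab0 mulr0; apply/esym/eqP; rewrite eq_le p0 andbT.
  by move/eqP: ab0; rewrite mulf_eq0 => /orP[/eqP <-|/eqP <-].
pose w (z : T * T) := W (iota z.1) (iota z.2).
have mw : measurable_fun setT w by exact: measurable_step2.
have sub_cell P A i : measurable A -> 0 <= fine (P (A `&` cell i)) <= fine (P (cell i)).
  move=> mA; rewrite fine_ge0//= fine_le ?fin_num_measure//.
  - exact: measurableI.
  - by apply: le_measure; rewrite ?inE//; exact: measurableI.
have ratio P A i (s : R) : measurable A -> s = fine (P (cell i)) ->
    fine (P (A `&` cell i)) * (s / fine (P (cell i))) = fine (P (A `&` cell i)).
  move=> mA ->; have := sub_cell P A i mA.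
  have [->|P0] := eqVneq (fine (P (cell i))) 0; last by rewrite mulfV// mulr1.
  by move=> ?; rewrite mul0r mulr0; lra.
have w1 : (\int[nu \x mu]_z (w z)%:E = 1)%E.
  have := integral_step2 nu mu measurableT measurableT W0.
  rewrite setXTT => ->; congr EFin.
  rewrite -(sum_cell nu); apply: eq_bigr => i _; rewrite -prow.
  by apply: eq_bigr => j _; rewrite !setTI Wab.
pose nm : probability (T * T)%type R := (nu \x mu)%E.
have [pi piw] := @probability_of_density _ _ _ nm w mw (fun z => W0 _ _) w1.
have [_ _ piE] := piw.
exists pi; split; last first.
  move=> c c0; rewrite (integral_density piw); last 2 first.
  - by apply/measurable_EFinP; exact: measurable_step2.
  - by move=> z; rewrite lee_fin.
  under eq_integral do rewrite -EFinM.
  have cW0 i j : 0 <= c i j * W i j by rewrite mulr_ge0.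
  have := integral_step2 nu mu measurableT measurableT cW0.
  rewrite setXTT => ->; congr EFin.
  apply: eq_bigr => i _; apply: eq_bigr => j _.
  by rewrite !setTI -mulrA Wab mulrC.
move=> A mA; split.
  rewrite /pushforward -[X in pi X](_ : A `*` setT = _); last first.
    by apply/seteqP; split => -[x y] /=; tauto.
  rewrite [LHS]piE; last exact: measurableX.
  rewrite [LHS](integral_step2 nu mu mA measurableT W0) -[RHS]fineK ?fin_num_measure//.
  congr EFin; rewrite -sum_setI_cell//; apply: eq_bigr => i _.
  rewrite -[RHS](ratio _ _ _ _ mA (prow i)) mulr_suml mulr_sumr; apply: eq_bigr => j _.
  rewrite setTI /W -/(a i) -/(b j).
  have [bj0|bj0] := eqVneq (b j) 0.
    have -> : p i j = 0 by apply/eqP; rewrite eq_le p0 andbT -bj0.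
    by rewrite !mul0r mulr0.
  have [ai0|ai0] := eqVneq (a i) 0; last by field; rewrite bj0 ai0.
  have -> : p i j = 0 by apply/eqP; rewrite eq_le p0 andbT -ai0.
  by rewrite !mul0r mulr0.
rewrite /pushforward -[X in pi X](_ : setT `*` A = _); last first.
  by apply/seteqP; split => -[x y] /=; tauto.
rewrite [LHS]piE; last exact: measurableX.
rewrite [LHS](integral_step2 nu mu measurableT mA W0) -[RHS]fineK ?fin_num_measure//.
congr EFin; rewrite -sum_setI_cell// exchange_big/=; apply: eq_bigr => j _.
rewrite -[RHS](ratio _ _ _ _ mA (pcol j)) mulr_suml mulr_sumr; apply: eq_bigr => i _.
rewrite setTI /W -/(a i) -/(b j).
have [ai0|ai0] := eqVneq (a i) 0.
  have -> : p i j = 0 by apply/eqP; rewrite eq_le p0 andbT -ai0.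
  by rewrite !mul0r mulr0.
have [bj0|bj0] := eqVneq (b j) 0; last by field; rewrite bj0 ai0.
have -> : p i j = 0 by apply/eqP; rewrite eq_le p0 andbT -bj0.
by rewrite !mul0r mulr0.
Qed.

End partition_coupling.

(** * Kantorovich duality *)

Section kantorovich.
Context (R : realType) (X : completeMetricType R) (alpha : R -> R).
Context (sepX : separable X) (ballX : compact_closed_balls X).
Context (young_alpha : young_function alpha) (delta2_alpha : delta2 alpha).
Implicit Types nu mu : probability (borel X) R.
Let ge0 := young_ge0 young_alpha.

(** [alpha] is even, hence not monotone on the line; composing with the positive part makes it
    monotone and so measurable. *)
Lemma young_measurable_comp d (T : measurableType d) (f : T -> R) :
  measurable_fun setT f -> (forall x, 0 <= f x) ->
  measurable_fun setT (fun x => alpha (f x)).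
Proof.
move=> mf f0; pose beta t := alpha (Num.max t 0).
rewrite (_ : (fun x => _) = beta \o f); last first.
  by apply/funext => x; rewrite /beta/= max_l.
apply: measurableT_comp => //.
apply: nondecreasing_measurable => // x y xy.
apply: (young_mono young_alpha); first by rewrite le_max lexx orbT.
by rewrite ge_max !le_max xy lexx orbT.
Qed.

Lemma measurable_young_mdist (x0 : X) :
  measurable_fun setT (fun x : borel X => alpha (mdist x0 (x : X))).
Proof.
apply: young_measurable_comp; first exact: measurable_mdist.
by move=> x; exact: mdist_ge0.
Qed.

Lemma measurable_young_mdist2 :
  measurable_fun setT (fun z : borel X * borel X => alpha (mdist (z.1 : X) (z.2 : X))).
Proof.
apply: young_measurable_comp; first exact: measurable_mdist2.
by move=> x; exact: mdist_ge0.
Qed.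

(** Selecting the first centre closer than [e] makes the balls disjoint; the level sets are built by
    recursion on the centres. *)
Lemma measurable_find_mdist (s : seq X) (e : R) n :
  measurable ([set x : X | find (fun u => mdist u x < e) s = n] : set (borel X)).
Proof.
have mball (u : X) : measurable ([set x : X | mdist u x < e] : set (borel X)).
  by apply: measurable_open; rewrite -ballEmdist; exact: open_mball.
elim: s n => [|u s ih] n /=.
  have [<-|n0] := eqVneq 0%N n.
    by rewrite (_ : [set _ | _] = setT)//; apply/seteqP.
  rewrite (_ : [set _ | _] = set0)//.
  by apply/seteqP; split => // x /= E; move: n0; rewrite E eqxx.
case: n => [|n].
  rewrite (_ : [set _ | _] = [set x : X | mdist u x < e])//.
  by apply/seteqP; split => x /=; case: ifP.
rewrite (_ : [set _ | _] = ~` [set x : X | mdist u x < e] `&`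
    [set x : X | find (fun u => mdist u x < e) s = n]).
  by apply: measurableI => //; exact: measurableC.
apply/seteqP; split => x /=; case: (mdist u x < e).
- by [].
- by move=> [<-]; split.
- by move=> [].
- by move=> [_ ->].
Qed.

(** Compactness of the closed ball yields finitely many centres; [None] labels the cell of points
    farther than [r] from [x0]. *)
Lemma ball_partition (x0 : X) (r e : R) : 0 < e ->
  exists (I : finType) (s : I -> X) (iota : X -> option I),
  [/\ forall i, measurable (iota @^-1` [set i] : set (borel X)),
      forall x i, iota x = Some i -> mdist (s i) x < e /\ mdist x0 x <= r &
      forall x, iota x = None -> r < mdist x0 x].
Proof.
move=> e0; have := @ballX x0 r; rewrite compact_cover.
move=> /(_ X setT (fun u => ball u e)).
case=> [u _|x _|D _ cov].
- exact: open_mball.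
- by exists x => //; exact: ballxx.
pose sq : seq X := finmap.enum_fset D.
pose fnd (x : X) := find (fun u => mdist u x < e) sq.
have fnd_lt x : mdist x0 x <= r -> (fnd x < size sq)%N.
  move=> xr; have [u /= uD ux] := cov x xr.
  rewrite -has_find; apply/hasP; exists u => //.
  by move: ux; rewrite ballEmdist.
exists 'I_(size sq), (fun i : 'I_(size sq) => nth x0 sq i),
  (fun x => if mdist x0 x <= r then insub (fnd x) else None); split.
- have mr : measurable ([set x : X | mdist x0 x <= r] : set (borel X)).
    have := measurable_mdist x0 measurableT (measurable_itv `]-oo, r]).
    by rewrite setTI (_ : _ @^-1` _ = [set x | mdist x0 x <= r])//;
      apply/seteqP; split => x; rewrite /= in_itv.
  case=> [i|].
    rewrite (_ : _ @^-1` _ = [set x | mdist x0 x <= r] `&` [set x | fnd x = i]).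
      by apply: measurableI => //; exact: measurable_find_mdist.
    apply/seteqP; split => x /=.
      by case: ifP => // xr; case: insubP => // j _ <- [->].
    by move=> [-> xi]; rewrite xi valK.
  rewrite (_ : _ @^-1` _ = ~` [set x | mdist x0 x <= r]); first exact: measurableC.
  apply/seteqP; split => x /=; case: ifP => // xr; case: insubP => //.
  by rewrite fnd_lt.
- move=> x i; case: ifP => // xr; case: insubP => // j _ fj [<-]; split => //.
  have := fnd_lt _ xr; rewrite -has_find => /(nth_find x0).
  by rewrite -/(fnd x) fj.
- move=> x; case: ifP => [xr|/negbT]; last by rewrite -ltNge.
  by case: insubP => //; rewrite fnd_lt.
Qed.

Lemma integral_tail_small nu (V g : borel X -> R) (e : R) :
  measurable_fun setT V -> measurable_fun setT g -> (forall x, 0 <= V x) ->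
  nu.-integrable setT (EFin \o V) -> 0 < e ->
  exists N : nat, forall n, (N <= n)%N ->
    (\int[nu]_x (if n%:R < g x then V x else 0)%:E <= e%:E)%E.
Proof.
move=> mV mg V0 iV e0.
pose f n (x : borel X) : \bar R := (if n%:R < g x then V x else 0)%:E.
have mf n : measurable_fun setT (f n).
  by apply/measurable_EFinP; apply: measurable_fun_ifT => //; exact: measurable_fun_ltr.
have H : (\int[nu]_x f n x @[n --> \oo] --> \int[nu]_x (cst 0 x))%E.
  apply: (@dominated_cvg _ _ _ nu setT measurableT f (cst 0%E) (EFin \o V) mf) => //.
    move=> x _; apply: (cvg_near_cst 0%E); exists (Num.truncn (g x)).+1 => // n /= gn.
    rewrite /f ltNge (_ : g x <= n%:R)//.
    by apply: le_trans (ltW (truncnS_gt _)) _; rewrite ler_nat.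
  by move=> n x _ /=; rewrite lee_fin; case: ifP => _; rewrite ?normr0// ger0_norm ?lexx.
rewrite integral0 in H.
have nb : nbhs (0%:E : \bar R) [set z | (z < e%:E)%E].
  apply: open_nbhs_nbhs; split; last by rewrite /= lte_fin.
  exact: open_ereal_lt_ereal.
have [N _ HN] := H _ nb.
by exists N => n Nn; apply: ltW; exact: (HN n Nn).
Qed.

(** Discretise the cost to [c] on a finite partition. The bound [c <= alpha + eta] makes discrete
    dual pairs nearly admissible; the bound [alpha <= c + eta] plus tails controls the cost of the
    lifted coupling. *)
Lemma transport_cost_le_dual nu mu (x0 : X) (D : R) :
  nu.-integrable setT (EFin \o (fun x : borel X => alpha (mdist x0 x))) ->
  mu.-integrable setT (EFin \o (fun x : borel X => alpha (mdist x0 x))) ->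
  (forall h f : X -> R, bounded_measurable (h : borel X -> R) ->
    bounded_measurable (f : borel X -> R) ->
    (forall x y, h x - f y <= alpha (mdist x y)) ->
    Rintegral nu setT h - Rintegral mu setT f <= D) ->
  (transport_cost alpha nu mu <= D%:E)%E.
Proof.
move=> iVnu iVmu dual.
pose V x := alpha (mdist x0 x).
apply/lee_addgt0Pr => eps eps0.
have [K K0 aK] := young_double young_alpha delta2_alpha.
(* The errors add up to [eta] from the dual, [eta] from the discretisation and [2 * K * eta] from
   the two tails. *)
pose eta := eps / (2 * K + 2).
have K2 : 0 < 2 * K + 2 by lra.
have eta0 : 0 < eta by rewrite divr_gt0.
have mV := measurable_young_mdist x0.
have md := measurable_mdist x0.
have [N1 HN1] := integral_tail_small mV md (fun x => ge0 _) iVnu eta0.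
have [N2 HN2] := integral_tail_small mV md (fun x => ge0 _) iVmu eta0.
pose n := maxn N1 N2; pose r : R := n%:R.
have r0 : 0 <= r by rewrite /r ler0n.
pose tail x := if r < mdist x0 x then V x else 0.
have tail0 x : 0 <= tail x by rewrite /tail; case: ifP => // _; exact: ge0.
have mtail : measurable_fun setT (tail : borel X -> R).
  by apply: measurable_fun_ifT => //; exact: measurable_fun_ltr.
have tailnu : (\int[nu]_x (tail x)%:E <= eta%:E)%E by apply: HN1; exact: leq_maxl.
have tailmu : (\int[mu]_x (tail x)%:E <= eta%:E)%E by apply: HN2; exact: leq_maxr.
(* [L] is the Lipschitz constant of [alpha] on [[0, 2 r + 2]], an interval containing the distances
   of near points and of their centres. *)
pose L := alpha (2 * r + 3).
have L0 : 0 <= L by exact: ge0.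
pose e := Num.min 1 (eta / (2 * L + 1)).
have e0 : 0 < e by rewrite lt_min ltr01 divr_gt0//; lra.
have e1 : e <= 1 by rewrite ge_min lexx.
have eL : 2 * L * e <= eta.
  have : e * (2 * L + 1) <= eta.
    by rewrite -ler_pdivlMr ?ge_min ?lexx ?orbT//; lra.
  nra.
have [I [s [iota [miota iotaS iotaN]]]] := ball_partition x0 r e0.
have lip u v : 0 <= u -> 0 <= v -> u <= 2 * r + 2 -> u <= v + 2 * e ->
    alpha u <= alpha v + eta.
  move=> u0 v0 ur uv; have [|/ltW vu] := leP u v.
    by move=> /(young_mono young_alpha u0); lra.
  have := young_lipschitz young_alpha v0 vu ur.
  have -> : alpha (2 * r + 2 + 1) = L by rewrite /L; congr alpha; ring.
  have : L * (u - v) <= L * (2 * e) by rewrite ler_wpM2l//; lra.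
  lra.
(* Pairs with a far cell cost [0], which keeps [c] below [alpha + eta]; the missing cost is charged
   to the tails in [le_c]. *)
pose c (i j : option I) := if (i, j) is (Some i', Some j') then alpha (mdist (s i') (s j')) else 0.
have c0 i j : 0 <= c i j by rewrite /c; case: i => // i; case: j => // j; exact: ge0.
have tri x y i j : iota x = Some i -> iota y = Some j ->
    [/\ mdist (s i) (s j) <= mdist x y + 2 * e, mdist x y <= mdist (s i) (s j) + 2 * e,
        mdist (s i) (s j) <= 2 * r + 2 & mdist x y <= 2 * r + 2].
  move=> /iotaS[sx xr] /iotaS[sy yr].
  have := metric_triangle (s i) x (s j); have := metric_triangle x y (s j).
  have := metric_triangle x (s i) y; have := metric_triangle (s i) (s j) y.
  have := metric_triangle x x0 y; rewrite (metric_sym x x0) (metric_sym y (s j)) (metric_sym x (s i)).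
  by split; lra.
have c_le x y : c (iota x) (iota y) <= alpha (mdist x y) + eta.
  rewrite /c; case xi : (iota x) => [i|]; last by have := ge0 (mdist x y); lra.
  case yj : (iota y) => [j|]; last by have := ge0 (mdist x y); lra.
  by have [t1 t2 t3 t4] := tri _ _ _ _ xi yj; apply: lip => //; exact: mdist_ge0.
have le_c x y : alpha (mdist x y) <= c (iota x) (iota y) + eta + K * (tail x + tail y).
  have Kt : 0 <= K * (tail x + tail y) by rewrite mulr_ge0 ?addr_ge0// ltW.
  (* The larger of the two distances to [x0] exceeds [r], so its [alpha] value is a tail term;
     doubling supplies [K]. *)
  have far : r < mdist x0 x \/ r < mdist x0 y ->
      alpha (mdist x y) <= K * (tail x + tail y).
    move=> xy; have xyx0 : mdist x y <= mdist x0 x + mdist x0 y.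
      by rewrite (metric_sym x0 x) metric_triangle.
    apply: le_trans (young_mono young_alpha (mdist_ge0 x y) xyx0) _.
    apply: le_trans (aK _ _ (mdist_ge0 _ _) (mdist_ge0 _ _)) _.
    rewrite ler_pM2l//; have [yx|/ltW yx] := leP (mdist x0 y) (mdist x0 x).
      have -> : alpha (mdist x0 x) = tail x.
        by rewrite /tail (_ : r < _)//; case: xy => // /lt_le_trans; apply.
      by rewrite lerDl.
    have -> : alpha (mdist x0 y) = tail y.
      by rewrite /tail (_ : r < _)//; case: xy => // /lt_le_trans; apply.
    by rewrite lerDr.
  have := c0 (iota x) (iota y); rewrite /c.
  case xi : (iota x) => [i|]; last by have := far (or_introl (iotaN _ xi)); lra.
  case yj : (iota y) => [j|]; last by have := far (or_intror (iotaN _ yj)); lra.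
  have [t1 t2 t3 t4] := tri _ _ _ _ xi yj => _.
  have := lip _ _ (mdist_ge0 x y) (mdist_ge0 (s i) (s j)) t4 t2; lra.
have [|p [p0 prow pcol pc]] := @finite_kantorovich R (option I)
  (fun i => fine (nu (iota @^-1` [set i]))) (fun i => fine (mu (iota @^-1` [set i])))
  c (D + eta) (fun i => fine_ge0 (measure_ge0 _ _)) (fun i => fine_ge0 (measure_ge0 _ _))
  (sum_cell miota nu) (sum_cell miota mu).
  move=> g f gf.
  (* Lowering [g] by [eta] makes the step functions admissible in the continuous dual problem. *)
  have := dual (fun x => g (iota x) - eta) (fun y => f (iota y)).
  have bg := bounded_measurable_step miota g.
  have bf := bounded_measurable_step miota f.
  have be := bounded_measurable_cst (borel X : measurableType _) eta.
  move=> /(_ (bounded_measurableB bg be) bf).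
  rewrite (expectB nu bg be) expect_cst (Rintegral_step miota) (Rintegral_step miota).
  have H2 x y : g (iota x) - eta - f (iota y) <= alpha (mdist x y).
    by have := gf (iota x) (iota y); have := c_le x y; lra.
  by move=> /(_ H2); lra.
have [pi [marg picost]] := exists_coupling_with_cells miota p0 prow pcol.
apply: (@le_trans _ _ (\int[pi]_z (alpha (mdist (z.1 : X) (z.2 : X)))%:E)%E).
  by apply: ereal_inf_lbound; exists pi.
have mc : measurable_fun setT (fun z : borel X * borel X => c (iota z.1) (iota z.2)).
  exact: (measurable_step2 miota).
have mt1 : measurable_fun setT (fun z : borel X * borel X => tail z.1).
  exact: (measurableT_comp mtail measurable_fst).
have mt2 : measurable_fun setT (fun z : borel X * borel X => tail z.2).
  exact: (measurableT_comp mtail measurable_snd).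
have int1 : (\int[pi]_z (tail z.1)%:E <= eta%:E)%E.
  apply: le_trans tailnu.
  rewrite -(@eq_measure_integral _ _ _ setT nu (pushforward pi fst)); last first.
    by move=> A mA _; have [] := marg A mA.
  rewrite ge0_integral_pushforward//; first exact/measurable_EFinP.
  by move=> y _; rewrite lee_fin.
have int2 : (\int[pi]_z (tail z.2)%:E <= eta%:E)%E.
  apply: le_trans tailmu.
  rewrite -(@eq_measure_integral _ _ _ setT mu (pushforward pi snd)); last first.
    by move=> A mA _; have [] := marg A mA.
  rewrite ge0_integral_pushforward//; first exact/measurable_EFinP.
  by move=> y _; rewrite lee_fin.
apply: (@le_trans _ _ (\int[pi]_z ((c (iota z.1) (iota z.2))%:E +
    (eta%:E + K%:E * ((tail z.1)%:E + (tail z.2)%:E))))%E).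
  apply: ge0_le_integral => //.
  - by move=> z _; rewrite lee_fin.
  - by apply/measurable_EFinP; exact: measurable_young_mdist2.
  - apply: emeasurable_funD; first exact/measurable_EFinP.
    apply: emeasurable_funD => //; apply: measurable_funeM.
    by apply: emeasurable_funD; exact/measurable_EFinP.
  - by move=> z _; rewrite -!EFinD lee_fin addrA; exact: le_c.
rewrite ge0_integralD//; last 4 first.
- by move=> z _; rewrite lee_fin.
- exact/measurable_EFinP.
- by move=> z _; rewrite -!EFinD lee_fin addr_ge0 ?(ltW eta0)// mulr_ge0 ?addr_ge0// ltW.
- apply: emeasurable_funD => //; apply: measurable_funeM.
  by apply: emeasurable_funD; exact/measurable_EFinP.
rewrite picost// ge0_integralD//; last 3 first.
- by move=> z _; rewrite lee_fin ltW.
- by move=> z _; rewrite -EFinD -EFinM lee_fin mulr_ge0 ?addr_ge0// ltW.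
- apply: measurable_funeM.
  by apply: emeasurable_funD; exact/measurable_EFinP.
have PT : ((pi : {measure set _ -> \bar R}) setT = 1)%E := probability_setT pi.
rewrite integral_cst// PT mule1 ge0_integralZl//; last 3 first.
- by apply: emeasurable_funD; exact/measurable_EFinP.
- by move=> z _; rewrite -EFinD lee_fin addr_ge0.
- by rewrite lee_fin ltW.
rewrite ge0_integralD//; last 4 first.
- by move=> z _; rewrite lee_fin.
- exact/measurable_EFinP.
- by move=> z _; rewrite lee_fin.
- exact/measurable_EFinP.
apply: (@le_trans _ _ ((D + eta)%:E + (eta%:E + K%:E * (eta%:E + eta%:E)))%E).
  apply: leeD; first by rewrite lee_fin.
  by apply: leeD => //; apply: lee_wpmul2l; [rewrite lee_fin ltW|exact: leeD].
rewrite -!EFinD lee_fin.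
have : eta * (2 * K + 2) = eps by rewrite /eta divfK// gt_eqF.
lra.
Qed.

End kantorovich.

(** * From the exponential inequality to transport *)

Lemma integrable_of_truncations d (T : measurableType d) (R : realType)
    (P : probability T R) (V : T -> R) (B : R) :
  measurable_fun setT V -> (forall x, 0 <= V x) ->
  (forall n : nat, Rintegral P setT (fun x => Num.min (V x) n%:R) <= B) ->
  P.-integrable setT (EFin \o V).
Proof.
move=> mV V0 VB.
pose g (n : nat) x : \bar R := (Num.min (V x) n%:R)%:E.
have mg n : measurable_fun setT (g n).
  by apply/measurable_EFinP; apply: measurable_minr.
have g0 n x : (0 <= g n x)%E by rewrite lee_fin le_min V0 ler0n.
have g_nd x : {homo g^~ x : n m / (n <= m)%N >-> (n <= m)%E}.
  move=> n m nm; rewrite lee_fin le_min !ge_min lexx/=.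
  by rewrite ler_nat nm orbT.
have bg n : bounded_measurable (fun x => Num.min (V x) n%:R).
  split; first exact: measurable_minr.
  by exists n%:R => x; rewrite ger0_norm ?le_min ?V0 ?ler0n// ge_min lexx orbT.
have glim x : limn (g^~ x) = (V x)%:E.
  apply: cvg_lim => //; apply: cvg_near_cst; exists (Num.truncn (V x)).+1 => // n /= Vn.
  rewrite /g min_l//; apply: le_trans (ltW (truncnS_gt _)) _.
  by rewrite ler_nat.
apply/integrableP; split; first exact/measurable_EFinP.
rewrite (eq_integral (fun x => limn (g^~ x))); last first.
  by move=> x _; rewrite glim /= ger0_norm.
rewrite monotone_convergence//; apply: (@le_lt_trans _ _ B%:E); last exact: ltry.
apply: lime_le.
  by apply: ereal_nondecreasing_is_cvgn => n m nm; apply: ge0_le_integral => // x _; exact: g_nd.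
by near=> n; rewrite (expect_EFin P (bg n)) lee_fin.
Unshelve. all: by end_near. Qed.

Section exponential_duality_to_transport.
Context (R : realType) (X : completeMetricType R) (alpha : R -> R).
Context (sepX : separable X) (ballX : compact_closed_balls X).
Context (young_alpha : young_function alpha) (delta2_alpha : delta2 alpha).
Context (mu : probability (borel X) R) (k : R) (k_gt0 : 0 < k).
Local Notation E f := (Rintegral mu setT f).
Let ge0 := young_ge0 young_alpha.

Context (expdual : forall h f : X -> R,
  bounded_measurable (h : borel X -> R) -> bounded_measurable (f : borel X -> R) ->
  (forall x y, h x - f y <= alpha (mdist x y)) ->
  ln (E (fun x : borel X => expR (k * h x))) <= k * E (f : borel X -> R)).

Let x0 : X := point.
Let V x := alpha (mdist x0 x).
Let mV : measurable_fun setT (V : borel X -> R).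
Proof. exact: measurable_young_mdist. Qed.
Let mind : measurable_fun setT (mdist x0 : borel X -> R).
Proof. exact: measurable_mdist. Qed.

Let minV M (x : borel X) := Num.min (V x) M.

Let bminV M : 0 <= M -> bounded_measurable (minV M).
Proof.
move=> M0; split; first exact: measurable_minr.
by exists M => x; rewrite ger0_norm ?le_min ?ge0// ge_min lexx orbT.
Qed.

Let V_triangle K x y : 0 < K ->
  (forall u v, 0 <= u -> 0 <= v -> alpha (u + v) <= K * alpha (Num.max u v)) ->
  K^-1 * V x <= alpha (mdist x y) + V y.
Proof.
move=> K0 aK; rewrite ler_pdivrMl//.
apply: (@le_trans _ _ (alpha (mdist x y + mdist x0 y))).
  apply: (young_mono young_alpha); first exact: mdist_ge0.
  by rewrite addrC (metric_sym x) metric_triangle.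
apply: le_trans (aK _ _ (mdist_ge0 _ _) (mdist_ge0 _ _)) _.
rewrite ler_pM2l//; have := ge0 (mdist x y); have := ge0 (mdist x0 y).
by rewrite /V; case: (leP (mdist x y) (mdist x0 y)); lra.
Qed.

(** Test the inequality with [h = min(V, n) / K] and [f = alpha r + (n / K) far], where [far] has
    mean at most one half. With [a = k / K], the mean of [expR (a min(V, n))] is at most a constant
    times [expR (a n / 2)], so the increments of the truncated means decay geometrically. *)
Lemma integrable_young_mdist : mu.-integrable setT (EFin \o (V : borel X -> R)).
Proof.
have [K K0 aK] := young_double young_alpha delta2_alpha.
have half0 : 0 < 2^-1 :> R by rewrite invr_gt0.
have [r Hr] := integral_tail_small (measurable_cst (1 : R)) mind (fun=> ler01)
  (bounded_measurable_integrable mu (bounded_measurable_cst _ 1)) half0.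
move: Hr => /(_ r (leqnn r)); pose far (x : borel X) : R := if r%:R < mdist x0 (x : X) then 1 else 0.
have bfar : bounded_measurable far.
  split; first by apply: measurable_fun_ifT => //; exact: measurable_fun_ltr.
  by exists 1 => x; rewrite /far; case: ifP; rewrite ?normr1 ?normr0.
rewrite -/far (expect_EFin mu bfar) lee_fin => Efar.
pose a := k / K; have a0 : 0 < a by rewrite divr_gt0.
have step n : E (minV n.+1%:R) - E (minV n%:R) <=
    expR (k * alpha r%:R) * expR (- (a / 2)) ^+ n.
  have n0 : 0 <= n%:R :> R by [].
  have bn := bminV n0; have bn1 : bounded_measurable (minV n.+1%:R) by exact: bminV.
  have bh : bounded_measurable (fun x => K^-1 * minV n%:R x) by exact: bounded_measurableZ.
  pose f (y : borel X) := alpha r%:R + n%:R / K * far y.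
  have bf : bounded_measurable f.
    by apply: bounded_measurableD; [exact: bounded_measurable_cst|exact: bounded_measurableZ].
  have hf x y : K^-1 * minV n%:R x - f y <= alpha (mdist x y).
    rewrite /f /far; case: ltP => [_|yr].
      have : K^-1 * minV n%:R x <= n%:R / K.
        by rewrite mulrC ler_pM2r ?invr_gt0// ge_min lexx orbT.
      by have := ge0 (mdist x y); have := ge0 r%:R; lra.
    have := V_triangle x y K0 aK.
    have : V y <= alpha r%:R by apply: (young_mono young_alpha) => //; exact: mdist_ge0.
    have : K^-1 * minV n%:R x <= K^-1 * V x by rewrite ler_pM2l ?invr_gt0// ge_min lexx.
    by lra.
  have := expdual bh bf hf.
  have -> : E f = alpha r%:R + n%:R / K * E far.
    rewrite expectD ?expect_cst ?expectZ//; first exact: bounded_measurable_cst.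
    exact: bounded_measurableZ.
  have be : bounded_measurable (fun x => expR (k * (K^-1 * minV n%:R x))).
    by apply: bounded_measurable_expR; exact: bounded_measurableZ.
  rewrite -ler_expR lnK; last first.
    by rewrite posrE; apply: expect_expR_gt0; exact: bounded_measurableZ.
  move=> Eexp.
  rewrite -expectB//; apply: (@le_trans _ _ (E (fun x => expR (- (a * n%:R)) * expR (k * (K^-1 * minV n%:R x))))).
    apply: expect_le; [exact: bounded_measurableB|exact: bounded_measurableZ|move=> x].
    rewrite -expRD; have -> : - (a * n%:R) + k * (K^-1 * minV n%:R x) = a * (minV n%:R x - n%:R).
      by rewrite /a; ring.
    (* Where [V >= n] the increment is at most [1] and the exponential equals [1]; elsewhere the
       increment is [0]. *)
    rewrite /minV; have [nV|/ltW Vn] := leP n%:R (V x).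
      by rewrite subrr mulr0 expR0 lerBlDr ge_min (addrC 1) natr1 lexx orbT.
    by rewrite min_l ?subrr ?expR_ge0//; apply: le_trans Vn _; rewrite ler_nat.
  rewrite expectZ//.
  apply: (@le_trans _ _ (expR (- (a * n%:R)) * expR (k * (alpha r%:R + n%:R / K * E far)))).
    by rewrite ler_pM2l// expR_gt0.
  rewrite -expRD -expRM_natl -expRD ler_expR.
  have : a * n%:R * E far <= a * n%:R * 2^-1.
    by rewrite ler_wpM2l// mulr_ge0// ltW.
  by rewrite /a; lra.
pose q := expR (- (a / 2)).
have q0 : 0 < q by exact: expR_gt0.
have q1 : q < 1 by rewrite -expR0 ltr_expR oppr_lt0 divr_gt0.
pose c := expR (k * alpha r%:R); have c0 : 0 < c by exact: expR_gt0.
apply: (@integrable_of_truncations _ _ _ mu V (c / (1 - q))) => [//|x|n]; first exact: ge0.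
rewrite -[leLHS]/(E (minV n%:R)).
apply: (@le_trans _ _ (c * (1 - q ^+ n) / (1 - q))); last first.
  rewrite ler_wpM2r ?invr_ge0 ?subr_ge0 ?(ltW q1)//.
  by rewrite -[leRHS]mulr1 ler_pM2l// lerBlDr lerDl exprn_ge0// ltW.
elim: n => [|n ih].
  rewrite expr0 subrr mulr0 mul0r -[leRHS](expect_cst mu 0).
  apply: expect_le; [exact: bminV|exact: bounded_measurable_cst|].
  by move=> x; rewrite ge_min lexx orbT.
have : c * (1 - q ^+ n.+1) / (1 - q) = c * (1 - q ^+ n) / (1 - q) + c * q ^+ n.
  by rewrite exprS; field; rewrite gt_eqF// subr_gt0.
by have := step n; rewrite -/q -/c; lra.
Qed.

(** Donsker-Varadhan applied to [k h], combined with [expdual], bounds every dual value by [H / k];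
    the duality theorem then bounds the cost. *)
Lemma transport_entropy_of_exponential_duality : transport_entropy alpha mu k^-1.
Proof.
move=> nu.
have kDV (h : borel X -> R) : bounded_measurable h ->
    ((k * Rintegral nu setT h - ln (E (fun x => expR (k * h x))))%:E <= relative_entropy nu mu)%E.
  move=> bh; have := @relative_entropy_ge _ _ _ mu nu (fun x => k * h x) (bounded_measurableZ k bh).
  by rewrite expectZ.
have H0 : (0 <= relative_entropy nu mu)%E.
  have := kDV _ (bounded_measurable_cst _ 0).
  by rewrite !expect_cst mulr0 expR0 ln1 subr0.
have [->|Hfin] := eqVneq (relative_entropy nu mu) +oo%E.
  by rewrite gt0_muley ?leey// lte_fin invr_gt0.
have HE : relative_entropy nu mu = (fine (relative_entropy nu mu))%:E.
  by rewrite fineK// ge0_fin_numE// ltey.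
set H := fine _ in HE; rewrite HE -EFinM.
have iVmu := integrable_young_mdist.
have [K K0 aK] := young_double young_alpha delta2_alpha.
pose m := E (V : borel X -> R).
(* The pair [min(V, n) / K] and [min(V, n / K)] is admissible, so finite entropy bounds the
   truncated [nu]-means of [V] uniformly. *)
have iVnu : nu.-integrable setT (EFin \o (V : borel X -> R)).
  apply: (@integrable_of_truncations _ _ _ nu V (K * (H / k + m))) => [//|x|n]; first exact: ge0.
  have bn : bounded_measurable (minV n%:R) by exact: bminV.
  have nK : 0 <= n%:R / K by rewrite divr_ge0// ltW.
  have bf := bminV nK.
  have bh : bounded_measurable (fun x => K^-1 * minV n%:R x) by exact: bounded_measurableZ.
  have hf x y : K^-1 * minV n%:R x - minV (n%:R / K) y <= alpha (mdist x y).
    rewrite lerBlDr.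
    have h1 : K^-1 * minV n%:R x <= K^-1 * V x by rewrite ler_pM2l ?invr_gt0// ge_min lexx.
    have h2 : K^-1 * minV n%:R x <= n%:R / K.
      by rewrite mulrC ler_pM2r ?invr_gt0// ge_min lexx orbT.
    have h3 := V_triangle x y K0 aK; have h4 := ge0 (mdist x y).
    by rewrite [X in _ + X]/minV; case: (leP (V y) (n%:R / K)) => _; lra.
  have Ef : E (minV (n%:R / K)) <= m.
    apply: le_Rintegral => //; first exact: bounded_measurable_integrable.
    by move=> x _; rewrite ge_min lexx.
  have := kDV _ bh; rewrite HE lee_fin expectZ//.
  have := expdual bh bf hf; rewrite -[X in X <= K * _]/(Rintegral nu setT (minV n%:R)).
  set W := ln _; set F := E _ in Ef *; set G := Rintegral nu _ _ => e1 e2.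
  rewrite -(ler_pM2l (divr_gt0 k_gt0 K0)).
  have -> : k / K * (K * (H / k + m)) = H + k * m by field; rewrite !gt_eqF.
  have : k * F <= k * m by rewrite ler_pM2l.
  lra.
apply: (transport_cost_le_dual sepX ballX young_alpha delta2_alpha iVnu iVmu).
move=> h f bh bf hf; rewrite ler_pdivlMl//.
have := kDV _ bh; rewrite HE lee_fin; have := expdual bh bf hf; lra.
Qed.

End exponential_duality_to_transport.

(** * From transport to the logarithmic Sobolev inequality *)

Section transport_to_tau_LSI.
Context (R : realType) (X : completeMetricType R) (alpha : R -> R).
Context (sepX : separable X) (young_alpha : young_function alpha).
Context (mu : probability (borel X) R).
Local Notation E f := (Rintegral mu setT f).

Lemma Rintegral_density d (T : measurableType d) (P nu : probability T R) w (g : T -> R) :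
  has_density P nu w -> bounded_measurable w -> bounded_measurable g ->
  Rintegral nu setT g = Rintegral P setT (fun x => g x * w x).
Proof.
move=> nuw bw bg; have [_ [M gM]] := bg; have [mw w0 nuE] := nuw.
have pos (h : T -> R) : bounded_measurable h -> (forall x, 0 <= h x) ->
    Rintegral nu setT h = Rintegral P setT (fun x => h x * w x).
  move=> bh h0; apply: EFin_inj; have bhw := bounded_measurableM bh bw.
  rewrite -(expect_EFin nu bh) -(expect_EFin P bhw).
  rewrite (integral_density nuw) => [//| |x]; last by rewrite lee_fin.
  by apply/measurable_EFinP; have [] := bh.
have {}gM x : `|g x| <= `|M| by exact: le_trans (gM x) (ler_norm _).
(* Adding the constant [N] reduces signed [g] to the nonnegative case. *)
set N := `|M| in gM; have M0 : 0 <= N by exact: normr_ge0.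
have bM := bounded_measurable_cst T N.
have bgM := bounded_measurableD bg bM.
have gM0 x : 0 <= g x + N by have := gM x; rewrite ler_norml => /andP[]; lra.
have e1 : Rintegral nu setT g = Rintegral nu setT (fun x => g x + N) - Rintegral nu setT (fun=> N).
  by rewrite expectD// addrK.
rewrite e1 (pos _ bgM gM0) (pos _ bM (fun=> M0)) -expectB.
- by apply: eq_Rintegral => x _; ring.
- exact: bounded_measurableM.
- exact: bounded_measurableM.
Qed.

(** The easy half of duality: integrate the pointwise bound against [pi] and read each term through
    its marginal. If the cost is not integrable, the right side is infinite. *)
Lemma coupling_dual_le nu (pi : probability (borel X * borel X)%type R) c (g f : X -> R) :
  coupling nu mu pi -> bounded_measurable (g : borel X -> R) ->
  bounded_measurable (f : borel X -> R) ->
  (forall x y, g x - f y <= c * alpha (mdist x y)) ->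
  0 <= c ->
  ((Rintegral nu setT (g : borel X -> R) - Rintegral mu setT (f : borel X -> R))%:E <=
   c%:E * \int[pi]_z (alpha (mdist (z.1 : X) (z.2 : X)))%:E)%E.
Proof.
move=> cpl bg bf gf c0.
have md := measurable_young_mdist2 sepX young_alpha.
have a0 z : 0 <= alpha (mdist (z.1 : X) (z.2 : X)) by exact: young_ge0.
rewrite -ge0_integralZl//; last 2 first.
- exact/measurable_EFinP.
- by move=> z _; rewrite lee_fin.
have push (P : probability (borel X) R) (phi : borel X * borel X -> borel X) (h : X -> R) :
    measurable_fun setT phi -> bounded_measurable (h : borel X -> R) ->
    (forall A, measurable A -> pushforward pi phi A = P A) ->
    bounded_measurable (h \o phi) /\ Rintegral P setT (h : borel X -> R) = Rintegral pi setT (h \o phi).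
  move=> mphi bh PE; have [mh [M hM]] := bh.
  have bhphi : bounded_measurable (h \o phi).
    by split; [exact: measurableT_comp|exists M => z; exact: hM].
  split => //; congr fine.
  rewrite -(@eq_measure_integral _ _ _ setT P (pushforward pi phi)); last first.
    by move=> A mA _; exact: PE.
  rewrite integral_pushforward//; first exact/measurable_EFinP.
  exact: (bounded_measurable_integrable pi bhphi).
have [bg1 ->] := push nu fst g measurable_fst bg (fun A mA => (cpl A mA).1).
have [bf2 ->] := push mu snd f measurable_snd bf (fun A mA => (cpl A mA).2).
have bG := bounded_measurableB bg1 bf2.
rewrite -(expectB pi bg1 bf2) -(expect_EFin pi bG).
have [fin|] := pselect (pi.-integrable setT (fun z : borel X * borel X => c%:E * (alpha (mdist (z.1 : X) (z.2 : X)))%:E)%E).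
  apply: le_integral => //; first exact: bounded_measurable_integrable.
  by move=> z _; rewrite -EFinM lee_fin; exact: gf.
move=> nint; rewrite (_ : (\int[pi]_z (c%:E * _))%E = +oo%E) ?leey//.
apply: contrapT => /eqP; rewrite -ltey => ifin; apply: nint.
apply/integrableP; split.
  by apply: measurable_funeM; exact/measurable_EFinP.
rewrite (eq_integral (fun z : borel X * borel X => c%:E * (alpha (mdist (z.1 : X) (z.2 : X)))%:E)%E)//.
by move=> z _; rewrite gee0_abs// mule_ge0// lee_fin.
Qed.

Lemma transport_entropy_tau_LSI C lambda : 0 < C -> transport_entropy alpha mu C ->
  0 < lambda -> lambda < 1 / C -> tau_LSI alpha mu lambda (1 / (1 - lambda * C)).
Proof.
move=> C0 TC l0 lC f bndf lf.
have lC1 : 0 < 1 - lambda * C by rewrite subr_gt0 -ltr_pdivlMr.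
have [M fM] : exists M : R, forall x, `|f x| <= M.
  have [M [_ HM]] := bndf; exists (`|M| + 1) => x; apply: HM => //.
  by rewrite (le_lt_trans (ler_norm _))// ltrDl.
have bf : bounded_measurable (f : borel X -> R).
  by split; [exact: locally_lipschitz_measurable|exists M].
have [q [bq qE _ q_le _]] := inf_convolutionE young_alpha l0 fM.
have be := bounded_measurable_expR bf.
set I := (\int[mu]_x _)%E.
have bI := bounded_measurableM (bounded_measurableB bf bq) be.
have -> : I = (E (fun x : borel X => (f x - q x) * expR (f x)))%:E.
  rewrite -(expect_EFin mu bI); apply: eq_integral => x _.
  by rewrite qE.
rewrite (entropy_expR mu bf) -EFinM lee_fin mul1r ler_pdivlMl//.
pose Z := E (fun x : borel X => expR (f x)).
have Z0 : 0 < Z by exact: expect_expR_gt0.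
pose w (x : borel X) := Z^-1 * expR (f x).
have bw : bounded_measurable w by exact: bounded_measurableZ.
have w0 x : 0 <= w x by rewrite mulr_ge0 ?expR_ge0// invr_ge0 ltW.
have w1 : (\int[mu]_x (w x)%:E = 1)%E.
  by rewrite (expect_EFin mu bw) expectZ// mulVf// gt_eqF.
have [nu nuw] := probability_of_density (proj1 bw) w0 w1.
have Enu (g : borel X -> R) : bounded_measurable g ->
    Rintegral nu setT g = Z^-1 * E (fun x => g x * expR (f x)).
  move=> bg; rewrite (Rintegral_density nuw bw bg) -expectZ; last exact: bounded_measurableM.
  by apply: eq_Rintegral => x _; rewrite /w; ring.
pose h := Rintegral nu setT (f : borel X -> R) - ln Z.
have bh := bounded_measurableB bf (bounded_measurable_cst (borel X : measurableType _) (ln Z)).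
have HE : relative_entropy nu mu = h%:E.
  rewrite (relative_entropy_density nuw) /h -[X in _ - X](expect_cst nu (ln Z)).
  rewrite -(expectB nu bf (bounded_measurable_cst (borel X : measurableType _) (ln Z))) -(expect_EFin nu bh).
  apply: eq_integral => x _; congr EFin.
  by rewrite /w lnM ?posrE ?invr_gt0 ?expR_gt0// lnV ?posrE// expRK addrC.
have hE : rentropy mu (f : borel X -> R) = Z * h.
  rewrite /h (Enu _ bf) /rentropy -/Z; field.
  by rewrite gt_eqF.
have main : Rintegral nu setT (q : borel X -> R) - E (f : borel X -> R) <= lambda * (C * h).
  (* A coupling optimal up to [eps / lambda] is used in place of a minimiser. *)
  apply/ler_addgt0Pr => eps eps0.
  have := TC nu; rewrite HE -EFinM => Tle.
  have : (transport_cost alpha nu mu < (C * h + eps / lambda)%:E)%E.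
    by apply: le_lt_trans Tle _; rewrite lte_fin ltrDl divr_gt0.
  move=> /ereal_inf_lt[_ [pi cpl <-] pilt].
  have qf x y : q x - f y <= lambda * alpha (mdist x y).
    by have := q_le x y; lra.
  have := coupling_dual_le cpl bq bf qf (ltW l0).
  move=> /le_trans/(_ (lee_wpmul2l (_ : (0 <= lambda%:E)%E) (ltW pilt))).
  rewrite lee_fin => /(_ (ltW l0)); rewrite -EFinM lee_fin => /le_trans; apply.
  by rewrite mulrDr lerD2l mulrCA mulfV ?mulr1// gt_eqF.
have jensen := rentropy_ge_jensen mu bf; rewrite -/Z in jensen.
have -> : E (fun x : borel X => (f x - q x) * expR (f x)) =
    Z * (Rintegral nu setT (f : borel X -> R) - Rintegral nu setT (q : borel X -> R)).
  rewrite -(expectB nu bf bq) (Enu _ (bounded_measurableB bf bq)) mulrA.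
  by rewrite mulfV ?mul1r// gt_eqF.
(* It remains to see [(1 - lambda C) h <= nu(f) - nu(q)]: by [main] and Jensen, [nu(q) <= lambda C h
   + mu(f) <= lambda C h + ln Z]. *)
rewrite hE mulrCA ler_pM2l//.
have : h = Rintegral nu setT (f : borel X -> R) - ln Z by [].
move: main jensen; lra.
Qed.

End transport_to_tau_LSI.

(** * Equivalence of the transport and logarithmic Sobolev inequalities *)

Theorem theorem1p8 (R : realType) (X : completeMetricType R)
    (sepX : separable X) (ballX : compact_closed_balls X)
    (mu : probability (borel X) R) (alpha : R -> R)
    (young_alpha : young_function alpha) (delta2_alpha : delta2 alpha)
    (p_gt1 : 1 < young_exponent alpha) :
  let p := young_exponent alpha in
  [/\ (exists2 C : R, 0 < C & transport_entropy alpha mu C) <->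
      (exists lambda A : R,
         [/\ 0 < lambda, 0 < A & tau_LSI alpha mu lambda A]),
      forall C : R, 0 < C -> transport_entropy alpha mu C ->
        forall lambda : R, 0 < lambda -> lambda < 1 / C ->
          tau_LSI alpha mu lambda (1 / (1 - lambda * C)) &
      forall lambda A : R, 0 < lambda -> 0 < A ->
        tau_LSI alpha mu lambda A ->
        transport_entropy alpha mu
          (1 / lambda * kappa p * Num.max A 1 `^ (p - 1))].
Proof.
move=> p.
have TtoL C : 0 < C -> transport_entropy alpha mu C ->
    forall lambda : R, 0 < lambda -> lambda < 1 / C ->
      tau_LSI alpha mu lambda (1 / (1 - lambda * C)).
  by move=> C0 TC lambda l0 lC; exact: transport_entropy_tau_LSI.
have const_gt0 lambda A : 0 < lambda ->
    0 < 1 / lambda * kappa p * Num.max A 1 `^ (p - 1).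
  move=> l0; rewrite kappa_powR//.
  have p0 : 0 < p by exact: lt_trans p_gt1.
  have q0 : 0 < p - 1 by rewrite subr_gt0.
  apply: mulr_gt0; last by rewrite powR_gt0// lt_max ltr01 orbT.
  apply: mulr_gt0; first exact: divr_gt0.
  by rewrite powR_gt0// mulr_gt0// powR_gt0// divr_gt0.
have LtoT lambda A : 0 < lambda -> 0 < A -> tau_LSI alpha mu lambda A ->
    transport_entropy alpha mu (1 / lambda * kappa p * Num.max A 1 `^ (p - 1)).
  move=> l0 A0 lsi; set C := _ * _; have C0 : 0 < C by exact: const_gt0.
  (* The exponential inequality holds for [k] strictly below [1 / C]; the endpoint constant follows
     by letting [c] decrease to [C]. *)
  have above c : C < c -> transport_entropy alpha mu c.
    move=> Cc; have c0 : 0 < c by exact: lt_trans Cc.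
    rewrite -[c]invrK; apply: transport_entropy_of_exponential_duality => //.
      by rewrite invr_gt0.
    have ci0 : 0 < c^-1 by rewrite invr_gt0.
    have cC : c^-1 * C < 1 by rewrite mulrC ltr_pdivrMr// mul1r.
    move=> h f bh bf hf.
    exact: (exponential_duality young_alpha delta2_alpha p_gt1 bh bf l0 lsi ci0 cC hf).
  move=> nu; apply/lee_addgt0Pr => eps eps0.
  have C1 : C < C + 1 by rewrite ltrDl.
  have [Hy|Hy] := eqVneq (relative_entropy nu mu) +oo%E.
    by rewrite Hy gt0_muley ?lte_fin// addye// leey.
  have H0 : (0 <= relative_entropy nu mu)%E.
    have := @relative_entropy_ge _ _ _ mu nu _ (bounded_measurable_cst _ 0).
    by rewrite !expect_cst expR0 ln1 subr0.
  have HE : relative_entropy nu mu = (fine (relative_entropy nu mu))%:E.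
    by rewrite fineK// ge0_fin_numE// ltey.
  rewrite HE; set H := fine _; have fH0 : 0 <= H by exact: fine_ge0.
  have H1 : 0 < H + 1 by exact: ltr_wpDl.
  (* This excess contributes at most [eps] after multiplication by [H]; the summand [1] covers zero
     entropy. *)
  have Ce : C < C + eps / (H + 1) by rewrite ltrDl divr_gt0.
  apply: le_trans (above _ Ce nu) _; rewrite HE -/H -!EFinM -EFinD lee_fin mulrDl lerD2l.
  by rewrite -mulrA -[leRHS]mulr1 ler_pM2l// ler_pdivrMl// mulr1 lerDl.
split=> //; split=> [[C C0 TC]|[lambda [A [l0 A0 lsi]]]].
  (* Any [lambda] in the open interval would do; the midpoint is taken. *)
  have l2 : 0 < 1 / (2 * C) by rewrite divr_gt0// mulr_gt0.
  have lC : 1 / (2 * C) < 1 / C by rewrite ltr_pM2l// ltf_pV2 ?posrE ?mulr_gt0//; lra.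
  exists (1 / (2 * C)), (1 / (1 - 1 / (2 * C) * C)); split => //; last exact: TtoL.
  by rewrite divr_gt0// subr_gt0 -ltr_pdivlMr.
by exists (1 / lambda * kappa p * Num.max A 1 `^ (p - 1)); [exact: const_gt0|exact: LtoT].
Qed.
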